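(* Let $d=1$ and let $\mathbb{P}$ be an ergodic, $T$-invariant environment measure on $\Omega$ of finite range $M$. Assume Kalikow's condition holds with $\ell=1$ (including the strong ellipticity condition). Then the process $(T^{X_n}\omega)_{n\ge0}$ has an invariant probability measure $\mathbb{P}_\infty$ that is absolutely continuous with respect to $\mathbb{P}$, and $$P_0\Big(\lim_{n\to\infty}\frac{X_n}{n}=\mathbb{E}^{\mathbb{P}_\infty}(D)\Big)=1.$$
   Context: An environment is $\omega=(\omega_{ij})_{i,j\in\mathbb{Z}}\in[0,1]^{\mathbb{Z}\times\mathbb{Z}}$ with $\sum_j\omega_{ij}=1$ for all $i$; write $\pi_{ij}(\omega)=\omega_{ij}$. $\Omega$ is the space of all environments with the product $\sigma$-field $\mathfrak{S}$, and shifts $(T^k\omega)_{ij}=\omega_{k+i,k+j}$, $k\in\mathbb{Z}$. An environment measure $\mathbb{P}$ is a probability measure on $(\Omega,\mathfrak{S})$; it is $T$-invariant and ergodic if it is so under $(T^k)_{k\in\mathbb{Z}}$; it has finite range $M$ ($1\le M<\infty$) if $\mathbb{P}(\pi_{ij}=0\text{ when }|i-j|>M)=1$. The quenched law $P_x^\omega$ is the law of the Markov chain $(X_n)_{n\ge0}$ on $\mathbb{Z}$ with $X_0=x$ and $P_x^\omega(X_{n+1}=j\mid X_n=i)=\pi_{ij}(\omega)$. The annealed law is $P_x=\int P_x^\omega\,d\mathbb{P}(\omega)$ (also regarded as the joint law of $(\omega,(X_n))$), with expectation $E_x$. The drift is $D(\omega)=\sum_i i\,\pi_{0i}(\omega)$.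 $\mathbb{E}^\mu$ denotes expectation under $\mu$. A probability measure $\mu$ on $\Omega$ is invariant for $(T^{X_n}\omega)_{n\ge0}$ if $\int\sum_{e}\pi_{0e}(\omega)\mathbf 1_A(T^e\omega)\,d\mu(\omega)=\mu(A)$ for all $A\in\mathfrak{S}$. Kalikow's condition (with $\ell=1$) consists of the following two requirements. (i) Strong ellipticity: there is $\kappa\in(0,1)$ with $\mathbb{P}(\pi_{ij}>\kappa\text{ whenever }|i-j|\le M)=1$. (ii) $$\inf_{U}\inf_{x\in U}\frac{E_0\big(\sum_{j=0}^{T_U}\mathbf 1(X_j=x)\,D(T^{X_j}\omega)\big)}{E_0\big(\sum_{j=0}^{T_U}\mathbf 1(X_j=x)\big)}>0,$$ where $T_U=\inf\{j\ge0:X_j\notin U\}$ and $U$ ranges over all finite $M$-connected subsets of $\mathbb{Z}$ containing $0$ ($M$-connected: there is a path inside $U$ with steps of absolute value at most $M$ passing through all its points). *)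

(* Defs.v *)
From HB Require Import structures.
From mathcomp Require Import all_boot all_order all_algebra.
From mathcomp Require Import all_classical all_reals all_analysis.

Set Implicit Arguments.
Unset Strict Implicit.
Unset Printing Implicit Defensive.

Import Order.TTheory GRing.Theory Num.Theory.
Import numFieldNormedType.Exports.

Local Open Scope classical_set_scope.
Local Open Scope ring_scope.

Record env (R : realType) := Env {
  env_fun :> int -> int -> R ;
  env_itv : forall i j, 0 <= env_fun i j <= 1 ;
  env_sum : forall i, (\esum_(j in [set: int]) (env_fun i j)%:E = 1)%E }.

Lemma env_id_itv (R : realType) (i j : int) : 0 <= ((i == j)%:R : R) <= 1.
Proof. by case: (i == j); rewrite ler01 lexx. Qed.

Lemma env_id_sum (R : realType) (i : int) :
  (\esum_(j in [set: int]) ((i == j)%:R : R)%:E = 1)%E.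
Proof.
rewrite -(@esum_set1 _ _ i (fun=> 1%E)) ?lee01// [RHS]esum_mkcond.
apply: eq_esum => j _; rewrite in_set1 eq_sym.
by case: (j == i).
Qed.

Section env_measurable.
Variable R : realType.

HB.instance Definition _ := gen_eqMixin (env R).
HB.instance Definition _ := gen_choiceMixin (env R).
HB.instance Definition _ :=
  isPointed.Build (env R) (Env (@env_id_itv R) (@env_id_sum R)).

(* Generators of the product sigma-algebra (trace on env). *)
Definition env_cyl : set (set (env R)) :=
  [set A | exists i j (B : set R),
     measurable B /\ A = [set w : env R | B (w i j)]].

HB.instance Definition _ := @isMeasurable.Build (sigma_display env_cyl)
  (env R) <<s env_cyl >> (@sigma_algebra0 _ setT env_cyl)
  (@sigma_algebraC _ env_cyl) (@sigma_algebra_bigcup _ setT env_cyl).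

End env_measurable.

Lemma shift_itv (R : realType) (k : int) (w : env R) (i j : int) :
  0 <= w (k + i) (k + j) <= 1.
Proof. exact: env_itv. Qed.

Lemma shift_sum (R : realType) (k : int) (w : env R) (i : int) :
  (\esum_(j in [set: int]) (w (k + i) (k + j))%:E = 1)%E.
Proof.
rewrite -(env_sum w (k + i)).
by rewrite [RHS](@reindex_esum _ _ _ [set: int] _ (fun j : int => k + j)).
Qed.

Definition env_shift (R : realType) (k : int) (w : env R) : env R :=
  Env (shift_itv k w) (shift_sum k w).

Definition shift_invariant (R : realType) (P : probability (env R) R) :=
  forall (k : int) (A : set (env R)), measurable A ->
    P (env_shift k @^-1` A) = P A.

Definition shift_ergodic (R : realType) (P : probability (env R) R) :=
  forall A : set (env R), measurable A ->
    (forall k : int, env_shift k @^-1` A = A) -> P A = 0%E \/ P A = 1%E.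

Definition finite_range (R : realType) (P : probability (env R) R) (M : nat) :=
  P [set w | forall i j : int, `|i - j| > M%:Z -> w i j = 0] = 1%E.

(* Sum of the positive terms minus sum of the negative ones.  'fine' discards
   information only when one of them is infinite, which has probability 0 under
   finite_range. *)
Definition drift (R : realType) (w : env R) : R :=
  fine (\esum_(i in [set: int]) (fun i : int => (i%:~R * w 0 i)%:E)^\+ i -
        \esum_(i in [set: int]) (fun i : int => (i%:~R * w 0 i)%:E)^\- i)%E.

(* Path space, with the product of the discrete sigma-algebras on int. *)
Definition walk := nat -> int.

HB.instance Definition _ := gen_eqMixin walk.
HB.instance Definition _ := gen_choiceMixin walk.
HB.instance Definition _ := isPointed.Build walk (fun=> 0).

Definition walk_cyl : set (set walk) :=
  [set A | exists (n : nat) (i : int), A = [set X : walk | X n = i]].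

HB.instance Definition _ := @isMeasurable.Build (sigma_display walk_cyl)
  walk <<s walk_cyl >> (@sigma_algebra0 _ setT walk_cyl)
  (@sigma_algebraC _ walk_cyl) (@sigma_algebra_bigcup _ setT walk_cyl).

(* Q is the law of the Markov chain started at x with transition probabilities
   w, specified by its finite-dimensional distributions. *)
Definition is_markov_law (R : realType) (w : env R) (x : int)
    (Q : probability walk R) :=
  forall (n : nat) (s : nat -> int),
    Q [set X : walk | forall k, (k <= n)%N -> X k = s k] =
    ((s 0%N == x)%:R * \prod_(k < n) w (s k) (s k.+1))%:E.

(* Existence: push Lebesgue measure on [0,1[ forward along the inverse-CDF
   simulation of the chain.  Every cylinder event pulls back to an interval
   whose length is the product of the transition probabilities. *)
Section markov_law_existence.
Context (R : realType) (w : env R).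

Let enumZ (n : nat) : int := if odd n then Negz n./2 else Posz n./2.
Let idxZ (i : int) : nat := match i with Posz m => m.*2 | Negz m => m.*2.+1 end.

Let idxZK : cancel idxZ enumZ.
Proof.
by case=> m; rewrite /enumZ/idxZ/= odd_double/= ?doubleK// uphalf_double.
Qed.

Let enumZK : cancel enumZ idxZ.
Proof.
move=> n; rewrite /enumZ /idxZ; case: ifPn => on.
  by rewrite -[RHS]odd_double_half on.
by rewrite -[RHS]odd_double_half (negbTE on).
Qed.

Let cum (i : int) (n : nat) : R := \sum_(0 <= k < n) w i (enumZ k).

Let w0 i j : 0 <= w i j. Proof. by have /andP[] := env_itv w i j. Qed.

Let cumS i n : cum i n.+1 = cum i n + w i (enumZ n).
Proof. by rewrite /cum big_nat_recr. Qed.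

Let cum_nd i : nondecreasing_seq (cum i).
Proof. by apply/nondecreasing_seqP => n; rewrite cumS lerDl. Qed.

Let cum_ge0 i n : 0 <= cum i n.
Proof. by rewrite /cum sumr_ge0. Qed.

Let cum_lim i : (\sum_(0 <= k <oo) (w i (enumZ k))%:E = 1)%E.
Proof.
rewrite nneseries_esumT; last by move=> n; rewrite lee_fin.
rewrite -(env_sum w i) [RHS](@reindex_esum _ _ _ [set: nat] _ enumZ)//.
split=> //; first by move=> x y _ _ /(can_inj enumZK).
by move=> y _; exists (idxZ y).
Qed.

Let cum_le1 i n : cum i n <= 1.
Proof.
rewrite -lee_fin -(cum_lim i) /cum -sumEFin.
by apply: nneseries_lim_ge => k _ _; rewrite lee_fin.
Qed.

Let cum_ex i (u : R) : 0 <= u < 1 -> exists n, cum i n <= u < cum i n.+1.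
Proof.
move=> /andP[u0 u1].
have [n un] : exists n, u < cum i n.
  apply: contrapT => /forallNP H.
  have : (\sum_(0 <= k <oo) (w i (enumZ k))%:E <= u%:E)%E.
    apply: lime_le; first by apply: is_cvg_nneseries => *; rewrite lee_fin.
    apply: nearW => n; rewrite sumEFin lee_fin leNgt; apply/negP; exact: H.
  by rewrite cum_lim lee_fin leNgt u1.
elim: n un => [|n IH]; first by rewrite /cum big_geq// ltNge u0.
by case: (ltP u (cum i n)) => [/IH//|un un1]; exists n; rewrite un un1.
Qed.

Let idx i u := xget 0%N [set n | cum i n <= u < cum i n.+1].

Let idxE i u n : cum i n <= u < cum i n.+1 -> idx i u = n.
Proof.
move=> nu; apply: xget_unique => //= m mu.
have aux p q : cum i p <= u < cum i p.+1 -> cum i q <= u < cum i q.+1 -> (p <= q)%N.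
  move=> /andP[p1 p2] /andP[q1 q2]; rewrite leqNgt; apply/negP => qp.
  by have := le_lt_trans p1 q2; rewrite ltNge cum_nd.
by apply/eqP; rewrite eqn_leq !aux.
Qed.

Let idxP i u : 0 <= u < 1 -> cum i (idx i u) <= u < cum i (idx i u).+1.
Proof. by move=> /(cum_ex i) [n nu]; rewrite (idxE nu). Qed.

(* The second component is the rescaled residual randomness. *)
Let step (z : int * R) : int * R :=
  let n := idx z.1 z.2 in
  (enumZ n, (z.2 - cum z.1 n) / w z.1 (enumZ n)).

Let path (i : int) (u : R) : walk := fun k => (iter k step (i, u)).1.

Let pathS i u k : path i u k.+1 = path (step (i, u)).1 (step (i, u)).2 k.
Proof. by rewrite /path iterSr; case: (step _). Qed.

Let path_itv n (s : nat -> int) : exists a : R,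
  let q := \prod_(k < n) w (s k) (s k.+1) in
  [/\ 0 <= a, a + q <= 1 &
   [set u : R | 0 <= u < 1 /\ forall k, (k <= n)%N -> path (s 0%N) u k = s k] =
   [set` `[a, a + q[%R] ].
Proof.
elim: n s => [|n IH] s /=.
  exists 0; rewrite big_ord0 add0r; split => //.
  rewrite set_itvE; apply/seteqP; split => u /=; first by case.
  by move=> u01; split=> // k; rewrite leqn0 => /eqP ->.
have [a [a0 a1 E]] := IH (fun k => s k.+1).
set q := \prod_(k < n) _ in a1 E.
set i := s 0%N; set p := idxZ (s 1%N).
have ep : enumZ p = s 1%N by rewrite /p idxZK.
exists (cum i p + w i (s 1%N) * a); rewrite big_ord_recl/= -/i.
have -> : \prod_(k < n) w (s (bump 0 k)) (s (bump 0 k).+1) = q by [].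
have w0' := w0 i (s 1%N).
have q0 : 0 <= q by apply: prodr_ge0 => k _.
have cS : cum i p.+1 = cum i p + w i (s 1%N) by rewrite cumS ep.
have c1 := cum_le1 i p.+1; have c0 := cum_ge0 i p.
split.
- by rewrite addr_ge0 ?mulr_ge0.
- rewrite -addrA -mulrDr (le_trans _ c1)// cS lerD2l.
  by rewrite ler_piMr.
rewrite -addrA -mulrDr set_itvE.
apply/seteqP; split => u /=.
  move=> [u01 H].
  have := H 1%N isT; rewrite /path/= => H1.
  have ip : idx i u = p by rewrite /p -H1 enumZK.
  have := idxP i u01; rewrite ip cS => /andP[u1 u2].
  have wgt : 0 < w i (s 1%N) by rewrite -(ltrD2l (cum i p)) addr0 (le_lt_trans u1).
  have : [set v : R | 0 <= v < 1 /\
      forall k, (k <= n)%N -> path (s 1%N) v k = s k.+1] ((u - cum i p) / w i (s 1%N)).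
    split.
      by rewrite divr_ge0 ?subr_ge0//= ltr_pdivrMr// mul1r ltrBlDl.
    move=> k kn; have := H k.+1 kn.
    by rewrite pathS /step/= ip ep.
  rewrite E/= in_itv/= ler_pdivlMr// ltr_pdivrMr// => /andP[].
  rewrite lerBrDl ltrBlDl => h1 h2.
  by rewrite [_ * a]mulrC h1/= mulrC.
move=> /andP[u1 u2].
have wgt : 0 < w i (s 1%N).
  rewrite lt_neqAle w0' andbT; apply/eqP => w00.
  by have := le_lt_trans u1 u2; rewrite -w00 !mul0r ltxx.
have uc : cum i p <= u < cum i p.+1.
  rewrite (le_trans _ u1) ?lerDl ?mulr_ge0//=.
  by rewrite (lt_le_trans u2)// cS lerD2l ler_piMr.
have ip := idxE uc.
have : [set` `[a, a + q[%R] ((u - cum i p) / w i (s 1%N)).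
  rewrite /= in_itv/= ler_pdivlMr// ltr_pdivrMr// lerBrDl ltrBlDl.
  by rewrite [a * _]mulrC u1 mulrC.
rewrite -E /= => -[_ H]; split.
  case/andP: uc => uc1 uc2; rewrite (le_trans c0 uc1)/=.
  exact: lt_le_trans uc2 c1.
case=> [//|k] kn; rewrite pathS /step/= ip ep; exact: H.
Qed.

Let D : set R := [set` `[0, 1[%R].

Let cylE x n (s : nat -> int) : exists a : R,
  let q := (s 0%N == x)%:R * \prod_(k < n) w (s k) (s k.+1) in
  0 <= q /\
  D `&` [set u | forall k, (k <= n)%N -> path x u k = s k] =
   [set` `[a, a + q[%R].
Proof.
have [<-|sx] := eqVneq (s 0%N) x.
  have [a [_ _ E]] := path_itv n s; exists a; rewrite mul1r; split.
    by apply: prodr_ge0 => k _.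
  by rewrite -E /D set_itvE; apply/seteqP; split => u [].
exists 0; rewrite mul0r /= addr0; split => //; rewrite set_itvxx; apply/seteqP; split => // u /=.
by move=> [_ /(_ 0%N isT)]; rewrite /path /= => e; rewrite e eqxx in sx.
Qed.

Let mD : measurable D. Proof. exact: measurable_itv. Qed.

Let measurable_path x : measurable_fun D (path x : R -> walk).
Proof.
apply: (@measurability _ _ _ _ _ _ walk_cyl) => // _ [_ [n [i ->]] <-].
have -> : D `&` path x @^-1` [set X | X n = i] =
  \bigcup_(t : seq int) (if nth 0 t n == i then
    D `&` [set u | forall k, (k <= n)%N -> path x u k = nth 0 t k] else set0).
  apply/seteqP; split => u /=.
    move=> [Du ui]; exists (mkseq (path x u) n.+1) => //=.
    rewrite nth_mkseq// ui eqxx; split => // k kn.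
    by rewrite nth_mkseq.
  by move=> [t _]; case: eqP => // <- [Du H]; split => //; rewrite /= H.
apply: countable_bigcupT_measurable => // t.
case: ifP => // _; have [a [_ ->]] := cylE x n (nth 0 t).
exact: measurable_itv.
Qed.

Definition coded_law (x : int) (A : set walk) : \bar R :=
  lebesgue_measure (D `&` path x @^-1` A).

Let law0 x : coded_law x set0 = 0%E.
Proof. by rewrite /coded_law preimage_set0 setI0 measure0. Qed.

Let law_ge0 x A : (0 <= coded_law x A)%E.
Proof. exact: measure_ge0. Qed.

Let law_sigma_additive x : semi_sigma_additive (coded_law x).
Proof.
move=> F mF tF mUF; rewrite /coded_law preimage_bigcup setI_bigcupr.
apply: measure_semi_sigma_additive.
- by move=> n; exact: measurable_path.
- by move=> i j _ _ [u [[_ Fi] [_ Fj]]]; apply: tF => //; exists (path x u).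
- by rewrite -setI_bigcupr -preimage_bigcup; exact: measurable_path.
Qed.

HB.instance Definition _ x := isMeasure.Build _ _ _ (coded_law x)
  (law0 x) (law_ge0 x) (@law_sigma_additive x).

Let law_setT x : coded_law x setT = 1%E.
Proof.
by rewrite /coded_law preimage_setT setIT lebesgue_measure_itv/= lte_fin ltr01 oppr0 adde0.
Qed.

HB.instance Definition _ x := Measure_isProbability.Build _ _ _ (coded_law x) (law_setT x).

Lemma markov_law_exists x : exists Q : probability walk R, is_markov_law w x Q.
Proof.
exists (coded_law x) => n s; rewrite /= /coded_law.
have [a [q0 E]] := cylE x n s.
rewrite [X in lebesgue_measure X]E lebesgue_measure_itv/= lte_fin ltrDl.
case: ltP => [_|q1]; first by rewrite -EFinD addrAC subrr add0r.
by congr EFin; apply/eqP; rewrite eq_le q0 q1.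
Qed.

End markov_law_existence.

Lemma measurable_walk_at (n : nat) (i : int) :
  measurable [set X : walk | X n = i].
Proof. by apply: sub_sigma_algebra; exists n, i. Qed.

Lemma measurable_walk_prefix (n : nat) (s : nat -> int) :
  measurable [set X : walk | forall k, (k <= n)%N -> X k = s k].
Proof.
have -> : [set X : walk | forall k, (k <= n)%N -> X k = s k] =
  \bigcap_(k in [set k | (k <= n)%N]) [set X : walk | X k = s k] by [].
by apply: bigcap_measurable => [|k _]; [exists 0%N|exact: measurable_walk_at].
Qed.

Lemma markov_law_unique (R : realType) (w : env R) (x : int)
    (Q1 Q2 : probability walk R) :
  is_markov_law w x Q1 -> is_markov_law w x Q2 ->
  forall A, measurable A -> Q1 A = Q2 A.
Proof.
move=> m1 m2.
pose G : set (set walk) := [set A | A = set0 \/ A = setT \/ exists n s,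
  A = [set X : walk | forall k, (k <= n)%N -> X k = s k]].
have Gm : G `<=` measurable.
  by move=> _ [->|[->|[n [s ->]]]] //; exact: measurable_walk_prefix.
apply: (measure_unique G (fun=> setT)).
- apply/seteqP; split; last exact: smallest_sub (@sigma_algebra_measurable _ _) Gm.
  apply: smallest_sub; first exact: smallest_sigma_algebra.
  move=> _ [n [i ->]].
  have -> : [set X : walk | X n = i] = \bigcup_(t : seq int)
     (if nth 0 t n == i then
      [set X : walk | forall k, (k <= n)%N -> X k = nth 0 t k] else set0).
    apply/seteqP; split => X /=.
      move=> Xi; exists (mkseq X n.+1) => //=.
      by rewrite nth_mkseq// Xi eqxx => k kn; rewrite nth_mkseq.
    by move=> [t _]; case: eqP => // <- /(_ n (leqnn n)).
  apply: (@countable_bigcupT_measurable _ (g_sigma_algebraType G)) => // t.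
  apply: sub_sigma_algebra; case: ifP => _; last by left.
  by right; right; exists n, (nth 0 t).
- move=> A B [->|[->|[n [s ->]]]]; first by move=> _; left; rewrite set0I.
    by rewrite setTI.
  move=> [->|[->|[m [t ->]]]]; first by left; rewrite setI0.
    by rewrite setIT; right; right; exists n, s.
  have [st|st] := pselect (forall k, (k <= n)%N -> (k <= m)%N -> s k = t k).
    right; right; exists (maxn n m), (fun k => if (k <= n)%N then s k else t k).
    apply/seteqP; split => X /=.
      by move=> [Xs Xt] k; rewrite leq_max; case: ifPn => [kn _|_]; [exact: Xs|exact: Xt].
    move=> H; split => k kn.
      by rewrite H ?kn// leq_max kn.
    by rewrite H ?leq_max ?kn ?orbT//; case: ifPn => // kn'; exact: st.
  left; apply/seteqP; split => [X [Xs Xt]|//].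
  by apply: st => k kn km; rewrite -Xs// Xt.
- by right; left.
- by rewrite bigcup_const//; exists 0%N.
- move=> _ [->|[->|[n [s ->]]]]; first by rewrite !measure0.
    by transitivity (1%E : \bar R); [|apply/esym]; exact: probability_setT.
  exact: etrans (m1 n s) (esym (m2 n s)).
- by move=> _; rewrite (@le_lt_trans _ _ 1%E) ?ltry// probability_le1.
Qed.

Definition quenched (R : realType) (w : env R) (x : int) : probability walk R :=
  projT1 (cid (markov_law_exists w x)).

Lemma quenched_markov (R : realType) (w : env R) (x : int) :
  is_markov_law w x (quenched w x).
Proof. by rewrite /quenched; case: cid. Qed.

(* Joint law of (environment, walk): integrate the quenched law over P. *)
Definition annealed (R : realType) (P : probability (env R) R) (x : int)
    (A : set (env R * walk)) : \bar R :=
  (\int[P]_w quenched w x [set X | A (w, X)])%E.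

Definition annealed_mean (R : realType) (P : probability (env R) R) (x : int)
    (f : env R * walk -> \bar R) : \bar R :=
  (\int[P]_w \int[quenched w x]_X f (w, X))%E.

(* +oo when the walk stays in U forever. *)
Definition exit_time (R : realType) (U : set int) (X : walk) : \bar R :=
  ereal_inf [set (n%:R)%:E | n in [set n : nat | ~ U (X n)]].

Definition M_connected (M : nat) (U : set int) :=
  exists (x : int) (s : seq int),
    path (fun a b : int => `|a - b| <= M%:Z) x s /\ U = [set` x :: s].

Definition kalikow_num (R : realType) (P : probability (env R) R)
    (U : set int) (x : int) : \bar R :=
  annealed_mean P 0 (fun wX =>
    \sum_(0 <= j <oo | (j%:R%:E <= exit_time R U wX.2)%E)
      ((wX.2 j == x)%:R * drift (env_shift (wX.2 j) wX.1))%:E)%E.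

Definition kalikow_den (R : realType) (P : probability (env R) R)
    (U : set int) (x : int) : \bar R :=
  annealed_mean P 0 (fun wX =>
    \sum_(0 <= j <oo | (j%:R%:E <= exit_time R U wX.2)%E)
      ((wX.2 j == x)%:R)%:E)%E.

Definition strongly_elliptic (R : realType) (P : probability (env R) R)
    (M : nat) :=
  exists kappa : R, 0 < kappa < 1 /\
    P [set w | forall i j : int, `|i - j| <= M%:Z -> w i j > kappa] = 1%E.

Definition kalikow (R : realType) (P : probability (env R) R) (M : nat) :=
  strongly_elliptic P M /\
  (0 < ereal_inf [set
     ereal_inf [set kalikow_num P U x / kalikow_den P U x | x in U]
     | U in [set U : set int | [/\ finite_set U, M_connected M U & U 0%R]]])%E.

Definition env_process_invariant (R : realType)
    (mu : probability (env R) R) :=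
  forall A : set (env R), measurable A ->
    (\int[mu]_w (\esum_(e in [set: int]) (w 0%R e * \1_A (env_shift e w))%:E)
     = mu A)%E.

(* Main.v *)
(* Kalikow's condition is only used through the Lyapunov function exp(- lam x):
   stopping it at the exit from a finite interval bounds, uniformly in the
   interval, the annealed expected number of visits to each site, weighted by
   exp(- lam x).  Hence P-almost surely the walk leaves every half-line ]-oo, K[,
   and G(0, 0) is P-integrable, where G is the quenched Green function.

   By ellipticity, the oscillation of a bounded function that is harmonic on a
   half-line ]-oo, K[ contracts geometrically from one block of M sites to the
   block on its left.  So bounded harmonic functions on Z are constant, and
   F = lim G(y, 0) as y -> -oo exists, with kappa <= F <= G(0, 0).  Passing to the
   limit in the recursion of G in its second argument shows that F, normalized,
   is the density of an invariant measure equivalent to P.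

   The event {sup_n (s X_n - a n) = +oo} is invariant under time shifts, so its
   quenched probability is a bounded harmonic function of the starting point,
   hence constant; a 0-1 law and the ergodicity of P make it 0 or 1 almost surely.
   If it is 1, the maximal ergodic inequality under the invariant measure gives
   a <= s E(D).  With s = 1 and s = -1 this is the law of large numbers. *)

Require Import Defs.
From HB Require Import structures.
From mathcomp Require Import all_boot all_order all_algebra.
From mathcomp Require Import all_classical all_reals all_analysis.
From mathcomp Require Import measurable_realfun.
From mathcomp Require Import ring lra zify.

Set Implicit Arguments.
Unset Strict Implicit.
Unset Printing Implicit Defensive.

Import Order.TTheory GRing.Theory Num.Theory.
Import numFieldNormedType.Exports.

Local Open Scope classical_set_scope.
Local Open Scope ring_scope.

(** * Quenched laws *)

Section walks.
Context {R : realType}.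
Implicit Types (w : env R) (x z : int).

(** Kalikow's condition controls the drift only on average over the environment, weighted by visits,
    and only in finite sets. An inequality that is linear in the visits, with weights independent of
    the environment, can still be integrated against [P]; the supermartingale inequality for a fixed
    function of the position is of this kind. An exponential serves because its first-order term
    reproduces the local drift, while the second-order error is uniform in the site and small
    against the drift once [lam] is small. Finite sets suffice since a walk of range [M] stays
    within distance [n * M] during [n] steps. An ergodic environment offers no independence, hence
    no renewal structure, and the invariant density needs another source. A walk started at -oo
    singles out no site: its expected number of visits to [z] is covariant under shifts, so it is
    one function of the environment seen from [z]. Nor is the environment process shown to be
    ergodic; a 0-1 law on path space takes the place of that. *)

Lemma env_ge0 w i j : 0 <= w i j. Proof. by have /andP[] := env_itv w i j. Qed.

Lemma env_le1 w i j : w i j <= 1. Proof. by have /andP[] := env_itv w i j. Qed.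

Definition wcons x (X : walk) : walk := fun n => if n is n'.+1 then X n' else x.

Definition wadd z (X : walk) : walk := fun n => z + X n.

Lemma measurable_to_walk d (T : measurableType d) (f : T -> walk) :
  (forall n i, measurable (f @^-1` [set X | X n = i])) ->
  measurable_fun [set: T] f.
Proof.
move=> mf; apply: (@measurability _ _ _ _ _ _ walk_cyl) => // _ [_ [n [i ->]] <-].
by rewrite setTI; exact: mf.
Qed.

Lemma measurable_wcons x : measurable_fun [set: walk] (wcons x).
Proof.
apply: measurable_to_walk => -[|n] i.
  have [->|xi] := eqVneq x i.
    by rewrite (_ : _ @^-1` _ = setT)//; apply/seteqP; split.
  rewrite (_ : _ @^-1` _ = set0)//; apply/seteqP; split => // X /= xi'.
  by rewrite xi' eqxx in xi.
exact: measurable_walk_at.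
Qed.

Lemma measurable_wadd z : measurable_fun [set: walk] (wadd z).
Proof.
apply: measurable_to_walk => n i.
rewrite (_ : _ @^-1` _ = [set X : walk | X n = i - z]).
  exact: measurable_walk_at.
apply/seteqP; split => X /=; rewrite /wadd.
  by move=> <-; rewrite addrAC subrr add0r.
by move=> ->; rewrite addrCA subrr addr0.
Qed.

HB.instance Definition _ x :=
  isMeasurableFun.Build _ _ _ _ (wcons x) (measurable_wcons x).

HB.instance Definition _ z :=
  isMeasurableFun.Build _ _ _ _ (wadd z) (measurable_wadd z).

(** Uniqueness for plain measures, so that mixtures and conditioned laws can be identified with a
    quenched law. Normalizing a measure of mass 1 leaves it unchanged and packages it as a
    probability. *)
Lemma quenched_uniq w x (m : {measure set walk -> \bar R}) :
  m setT = 1%E ->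
  (forall (n : nat) (s : nat -> int),
    m [set X : walk | forall k, (k <= n)%N -> X k = s k] =
    ((s 0%N == x)%:R * \prod_(k < n) w (s k) (s k.+1))%:E) ->
  forall A, measurable A -> quenched w x A = m A.
Proof.
move=> m1 mE A mA.
have mn B : mnormalize m (quenched w x) B = m B.
  by rewrite /mnormalize m1 onee_eq0/= invr1 mule1.
rewrite -mn; apply: markov_law_unique mA; first exact: quenched_markov.
by move=> n s; rewrite -mE -mn.
Qed.

Lemma quenched_shift w z x (A : set walk) : measurable A ->
  quenched w (z + x) A = quenched (env_shift z w) x (wadd z @^-1` A).
Proof.
move=> mA.
rewrite (@quenched_uniq w (z + x) (distribution (quenched (env_shift z w) x) (wadd z)))//.
  exact: probability_setT.
move=> n s; rewrite /distribution /pushforward/=.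
transitivity (quenched (env_shift z w) x
    [set X | forall k, (k <= n)%N -> X k = s k - z]).
  congr (quenched _ _ _); apply/seteqP; split=> X /= H k kn.
    by rewrite -H// /wadd addrAC subrr add0r.
  by rewrite /wadd H// addrCA subrr addr0.
rewrite quenched_markov; congr EFin; congr *%R.
  by rewrite -(inj_eq (addrI z)) addrCA subrr addr0.
by apply: eq_bigr => k _ /=; congr (w _ _); rewrite addrCA subrr addr0.
Qed.

Lemma measurable_env_at (i j : int) : measurable_fun [set: env R] (fun w => w i j).
Proof.
move=> _ B mB; rewrite setTI; apply: sub_sigma_algebra.
by exists i, j, B.
Qed.

Lemma measurable_env_shift z : measurable_fun [set: env R] (env_shift z).
Proof.
apply: (@measurability _ _ _ _ _ _ (@env_cyl R)) => // _ [_ [i [j [B [mB ->]]]] <-].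
by rewrite setTI; apply: sub_sigma_algebra; exists (z + i), (z + j), B.
Qed.

HB.instance Definition _ z :=
  isMeasurableFun.Build _ _ _ _ (@env_shift R z) (measurable_env_shift z).

(** Dynkin's argument: prefix events form a pi-system on which the probability is a finite product
    of entries of [w], and the sets whose probability is measurable in [w] form a lambda-system. *)
Lemma measurable_quenched x (A : set walk) : measurable A ->
  measurable_fun [set: env R] (fun w => quenched w x A).
Proof.
pose G : set (set walk) := [set A | A = set0 \/ exists n s,
  A = [set X : walk | forall k, (k <= n)%N -> X k = s k]].
pose H : set (set walk) := [set A | measurable A /\
  measurable_fun [set: env R] (fun w => quenched w x A)].
have GH : G `<=` H.
  move=> _ [->|[n [s ->]]]; split => //.
  - by under eq_fun do rewrite measure0; exact: measurable_cst.
  - exact: measurable_walk_prefix.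
  - under eq_fun do rewrite quenched_markov.
    apply/measurable_EFinP; apply: measurable_funM => //.
    by apply: measurable_prod => k _; exact: measurable_env_at.
have GI : setI_closed G.
  move=> C D [->|[n [s ->]]]; first by move=> _; left; rewrite set0I.
  move=> [->|[m [t ->]]]; first by left; rewrite setI0.
  have [st|st] := pselect (forall k, (k <= n)%N -> (k <= m)%N -> s k = t k).
    right; exists (maxn n m), (fun k => if (k <= n)%N then s k else t k).
    apply/seteqP; split => X /=.
      by move=> [Xs Xt] k; rewrite leq_max; case: ifPn => [kn _|_]; [exact: Xs|exact: Xt].
    move=> HX; split => k kn.
      by rewrite HX ?kn// leq_max kn.
    by rewrite HX ?leq_max ?kn ?orbT//; case: ifPn => // kn'; exact: st.
  left; apply/seteqP; split => [X [Xs Xt]|//].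
  by apply: st => k kn km; rewrite -Xs// Xt.
have HL : lambda_system setT H.
  split => //.
  - by split => //; under eq_fun do rewrite probability_setT; exact: measurable_cst.
  - move=> C D DC [mC fC] [mD fD]; split; first exact: measurableD.
    rewrite (_ : (fun _ => _) = (fun w => quenched w x C - quenched w x D)%E).
      exact: emeasurable_funB.
    apply/funext => w; rewrite measureD//; last by rewrite ltey_eq fin_num_measure.
    by rewrite setIidr.
  - move=> F ndF HF; split; first by apply: bigcup_measurable => n _; have [] := HF n.
    apply: (emeasurable_fun_cvg (fun n w => quenched w x (F n))) => [n|w _].
      by have [] := HF n.
    apply: nondecreasing_cvg_mu => //; first by move=> n; have [] := HF n.
    by apply: bigcup_measurable => n _; have [] := HF n.
move=> mA.
suff: H A by case.
suff : measurable `<=` <<s G >>.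
  by move=> /(_ A mA); apply: lambda_system_subset.
apply: smallest_sub; first exact: smallest_sigma_algebra.
move=> _ [n [i ->]].
have -> : [set X : walk | X n = i] = \bigcup_(t : seq int)
   (if nth 0 t n == i then
    [set X : walk | forall k, (k <= n)%N -> X k = nth 0 t k] else set0).
  apply/seteqP; split => X /=.
    move=> Xi; exists (mkseq X n.+1) => //=.
    by rewrite nth_mkseq// Xi eqxx => k kn; rewrite nth_mkseq.
  by move=> [t _]; case: eqP => // <- /(_ n (leqnn n)).
apply: (@countable_bigcupT_measurable _ (g_sigma_algebraType G)) => // t.
apply: sub_sigma_algebra; case: ifP => _; last by left.
by right; exists n, (nth 0 t).
Qed.

End walks.

(** * One-step decomposition under finite range *)

Section neighbours.
Context {R : realType} (M : nat).
Implicit Types (w : env R) (x z : int).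

(* As k runs through 'I_(2M+1), nb x k runs through the sites within M of x. *)
Definition nb (x : int) (k : nat) : int := x + (k%:Z - M%:Z).

Definition ranged w := forall i j : int, `|i - j| > M%:Z -> w i j = 0.

Lemma nb_inj x : injective (nb x).
Proof. by move=> i j; rewrite /nb => /addrI; lia. Qed.

Lemma nbD z x k : nb (z + x) k = z + nb x k.
Proof. by rewrite /nb -addrA. Qed.

Lemma nbP x j : `|x - j| <= M%:Z -> exists k : 'I_(M.*2.+1), j = nb x k.
Proof.
move=> xj.
have kM : (absz (j - x + M%:Z)%R < M.*2.+1)%N by lia.
by exists (Ordinal kM); rewrite /nb /=; lia.
Qed.

Lemma nb_dist x (k : 'I_(M.*2.+1)) : `|x - nb x k| <= M%:Z.
Proof. by have := ltn_ord k; rewrite /nb; lia. Qed.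

Lemma esum_nb x (f : int -> \bar R) : (forall j, 0 <= f j)%E ->
  (forall j, `|x - j| > M%:Z -> f j = 0%E) ->
  (\esum_(j in [set: int]) f j = \sum_(k < M.*2.+1) f (nb x k))%E.
Proof.
move=> f0 fM.
pose e (k : 'I_(M.*2.+1)) := nb x k.
rewrite (_ : \esum_(j in setT) f j = \esum_(j in range e) f j)%E.
  rewrite esum_image; last by move=> i j _ _ /nb_inj; exact: val_inj.
  rewrite esum_fset//; last exact: finite_finset.
  rewrite [RHS]fsbig_seq ?index_enum_uniq//; apply: eq_fsbigl.
  by apply/seteqP; split => // k _; rewrite /= mem_index_enum.
rewrite [RHS]esum_mkcond; apply: eq_esum => j _.
case: ifPn => // /negP; rewrite inE/= => je; apply: fM; rewrite ltNge; apply/negP => /nbP[k jk].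
by apply: je; exists k.
Qed.

Lemma env_sum_nb w x : ranged w -> \sum_(k < M.*2.+1) w x (nb x k) = 1.
Proof.
move=> wM; apply: EFin_inj; rewrite -(env_sum w x) (@esum_nb x) ?sumEFin//.
  by move=> j; rewrite lee_fin env_ge0.
by move=> j xj; rewrite wM.
Qed.

Lemma ranged_shift w z : ranged w -> ranged (env_shift z w).
Proof. by move=> wM i j ij; rewrite /= wM// opprD addrACA subrr add0r. Qed.

(** The mixture, over the first step, of the laws restarted at the neighbours with [x] put in front.
    Building it from [msum], [mscale] and [distribution] makes it a measure without further
    proof. *)
Definition stepm w x : {measure set walk -> \bar R} :=
  msum (fun k => mscale (NngNum (env_ge0 w x (nb x k)))
    (distribution (quenched w (nb x k)) (wcons x))) M.*2.+1.

Lemma stepmE w x A : stepm w x A =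
  (\sum_(k < M.*2.+1) (w x (nb x k))%:E * quenched w (nb x k) (wcons x @^-1` A))%E.
Proof. by []. Qed.

Lemma quenched_step w x (A : set walk) : ranged w -> measurable A ->
  quenched w x A =
  (\sum_(k < M.*2.+1) (w x (nb x k))%:E * quenched w (nb x k) (wcons x @^-1` A))%E.
Proof.
move=> wM mA; rewrite -stepmE; apply: quenched_uniq => // [|n s].
  rewrite stepmE; under eq_bigr do rewrite probability_setT mule1.
  by rewrite sumEFin env_sum_nb.
rewrite stepmE.
have [s0x|s0x] := eqVneq (s 0%N) x; last first.
  rewrite mul0r big1// => k _; rewrite [X in quenched _ _ X](_ : _ = set0) ?measure0 ?mule0//.
  by apply/seteqP; split => // X /= /(_ 0%N isT)/= xs; rewrite xs eqxx in s0x.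
rewrite mul1r; case: n => [|n].
  rewrite big_ord0.
  under eq_bigr => k _.
    rewrite (_ : wcons x @^-1` _ = setT); last first.
      by apply/seteqP; split => // X _ /= k'; rewrite leqn0 => /eqP->.
    rewrite probability_setT mule1; over.
  by rewrite sumEFin env_sum_nb.
transitivity (\sum_(k < M.*2.+1) (w x (nb x k) *
   ((s 1%N == nb x k)%:R * \prod_(i < n) w (s i.+1) (s i.+2)))%:E)%E.
  apply: eq_bigr => k _; rewrite EFinM; congr (_ * _)%E.
  rewrite -(quenched_markov w (nb x k) n (fun i => s i.+1)); congr (quenched _ _ _).
  apply/seteqP; split => X /= H.
    by move=> i i_n; have := H i.+1 i_n.
  by move=> [_|i i_n]; [rewrite s0x|exact: H].
rewrite sumEFin big_ord_recl/= s0x; congr EFin.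
have [xs|xs] := leP `|x - s 1%N| M%:Z; last first.
  rewrite wM// mul0r big1// => k _.
  by case: eqP => [e|_]; [move: xs; rewrite e ltNge nb_dist|rewrite mul0r mulr0].
have [k ke] := nbP xs.
rewrite (bigD1 k)//= -ke eqxx mul1r [X in _ + X]big1 ?addr0// => i ik.
rewrite ke; case: eqP => [/nb_inj/val_inj ki|_]; last by rewrite mul0r mulr0.
by rewrite ki eqxx in ik.
Qed.

Lemma integral_quenched_step w x (f : walk -> \bar R) : ranged w ->
  measurable_fun [set: walk] f -> (forall X, 0 <= f X)%E ->
  (\int[quenched w x]_X f X =
   \sum_(k < M.*2.+1) (w x (nb x k))%:E * \int[quenched w (nb x k)]_X f (wcons x X))%E.
Proof.
move=> wM mf f0.
rewrite (eq_measure_integral (stepm w x)); last first.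
  by move=> A mA _; exact: quenched_step.
rewrite /stepm ge0_integral_measure_sum//; apply: eq_bigr => k _.
rewrite ge0_integral_mscale//=; congr (_ * _)%E.
by rewrite ge0_integral_pushforward.
Qed.

End neighbours.

(** * Killed walks and harmonic functions *)

Section operators.
Context {R : realType} (M : nat).
Implicit Types (w : env R) (x y z : int) (U V : pred int) (phi psi : int -> R).

Definition Qop w phi x : R := \sum_(k < M.*2.+1) w x (nb M x k) * phi (nb M x k).

(* kst w U j phi x is the expectation of phi(X_j) on the event that
   X_0, ..., X_j all lie in U, for the walk in w started at x. *)
Fixpoint kst w U j phi x : R :=
  if U x then (if j is j'.+1 then Qop w (kst w U j' phi) x else phi x) else 0.

Definition delta z y : R := (y == z)%:R.

Lemma delta_ge0 z y : 0 <= delta z y. Proof. exact: ler0n. Qed.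

Lemma Qop_le w phi psi x : (forall k : 'I_(M.*2.+1), phi (nb M x k) <= psi (nb M x k)) ->
  Qop w phi x <= Qop w psi x.
Proof. by move=> le; apply: ler_sum => k _; rewrite ler_wpM2l ?env_ge0. Qed.

Lemma eq_Qop w phi psi x : (forall k : 'I_(M.*2.+1), phi (nb M x k) = psi (nb M x k)) ->
  Qop w phi x = Qop w psi x.
Proof. by move=> le; apply: eq_bigr => k _; rewrite le. Qed.

Lemma Qop_ge0 w phi x : (forall y, 0 <= phi y) -> 0 <= Qop w phi x.
Proof. by move=> p0; apply: sumr_ge0 => k _; rewrite mulr_ge0 ?env_ge0. Qed.

Lemma Qop_affine w (a c : R) phi x : ranged M w ->
  Qop w (fun y => a + c * phi y) x = a + c * Qop w phi x.
Proof.
move=> wM; rewrite /Qop mulr_sumr -[X in X + _]mulr1 -(env_sum_nb x wM) mulr_sumr -big_split/=.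
by apply: eq_bigr => k _; rewrite mulrDr mulrCA [_ * a]mulrC.
Qed.

Lemma Qop_sum w I (r : seq I) (c : I -> R) (phi : I -> int -> R) x :
  Qop w (fun y => \sum_(i <- r) c i * phi i y) x = \sum_(i <- r) c i * Qop w (phi i) x.
Proof.
rewrite /Qop; under eq_bigr do rewrite mulr_sumr.
rewrite exchange_big; apply: eq_bigr => i _; rewrite mulr_sumr.
by apply: eq_bigr => k _; rewrite mulrCA.
Qed.

Lemma Qop_le_cst w phi x C : ranged M w ->
  (forall k : 'I_(M.*2.+1), phi (nb M x k) <= C) -> Qop w phi x <= C.
Proof.
move=> wM le; rewrite (le_trans (Qop_le w (psi := fun=> C) le))//.
by rewrite /Qop -mulr_suml env_sum_nb// mul1r.
Qed.

Lemma kst_out w U j phi x : ~~ U x -> kst w U j phi x = 0.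
Proof. by case: j => [|j] /= /negbTE ->. Qed.

Lemma kst_in w U j phi x : U x -> kst w U j.+1 phi x = Qop w (kst w U j phi) x.
Proof. by move=> /= ->. Qed.

Lemma kst_ge0 w U j phi x : (forall y, U y -> 0 <= phi y) -> 0 <= kst w U j phi x.
Proof.
move=> p0; elim: j x => [|j IH] x /=; case: ifPn => // Ux; first exact: p0.
exact: Qop_ge0.
Qed.

Lemma kst_le w U j phi psi x : (forall y, U y -> phi y <= psi y) ->
  kst w U j phi x <= kst w U j psi x.
Proof.
move=> le; elim: j x => [|j IH] x /=; case: ifPn => // Ux; first exact: le.
exact: Qop_le.
Qed.

Lemma eq_kst w U j phi psi x : (forall y, U y -> phi y = psi y) ->
  kst w U j phi x = kst w U j psi x.
Proof.
by move=> e; apply/eqP; rewrite eq_le; apply/andP; split; apply: kst_le => y Uy; rewrite e.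
Qed.

Lemma kst_sum w U j I (r : seq I) (c : I -> R) (phi : I -> int -> R) x :
  kst w U j (fun y => \sum_(i <- r) c i * phi i y) x =
  \sum_(i <- r) c i * kst w U j (phi i) x.
Proof.
elim: j x => [|j IH] x /=; case: ifPn => // Ux; try by rewrite big1// => i _; rewrite mulr0.
rewrite -Qop_sum; apply: eq_Qop => k; exact: IH.
Qed.

Lemma kstB w U j phi psi x :
  kst w U j (fun y => phi y - psi y) x = kst w U j phi x - kst w U j psi x.
Proof.
elim: j x => [|j IH] x /=; case: ifPn => //; rewrite ?subr0// => _.
by rewrite /Qop -sumrB; apply: eq_bigr => k _; rewrite IH mulrBr.
Qed.

(** [kst] recurses on the first step; this isolates the last one, as telescoping and the recursion
    of the Green function in its target require. *)
Lemma kstSr w U j phi x :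
  kst w U j.+1 phi x = kst w U j (Qop w (fun y => if U y then phi y else 0)) x.
Proof.
elim: j x => [|j IH] x /=; case: ifPn => // Ux.
apply: eq_Qop => k; exact: IH.
Qed.

Lemma kst_shift w z U j phi x :
  kst (env_shift z w) U j phi x =
  kst w (fun y => U (y - z)) j (fun y => phi (y - z)) (z + x).
Proof.
elim: j x => [|j IH] x /=; rewrite [z + x - z]addrAC subrr add0r//; case: ifPn => // _.
by apply: eq_bigr => k _; rewrite nbD IH.
Qed.

(** Within [j] steps the walk travels at most [j * M], so only the part of the domain that close to
    [x] counts. Bounds uniform over finite intervals reach half-lines and the whole line in this
    way. *)
Lemma kst_local w U V j phi x :
  (forall y, `|x - y| <= (j * M)%N%:Z -> U y = V y) ->
  kst w U j phi x = kst w V j phi x.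
Proof.
elim: j x => [|j IH] x UV /=; rewrite -UV; try lia; case: ifPn => // _.
apply: eq_Qop => k; apply: IH => y xy; apply: UV.
by have := nb_dist x k; rewrite mulSn PoszD; lia.
Qed.

Lemma measurable_Qop x (phi : env R -> int -> R) :
  (forall y, measurable_fun [set: env R] (phi ^~ y)) ->
  measurable_fun [set: env R] (fun w => Qop w (phi w) x).
Proof.
move=> mphi; apply: measurable_sum => k; apply: measurable_funM => //.
exact: measurable_env_at.
Qed.

Lemma measurable_kst U j phi x : measurable_fun [set: env R] (fun w => kst w U j phi x).
Proof.
elim: j x => [|j IH] x /=; case: (U x) => //.
exact: measurable_Qop.
Qed.

(** Transposition of the kernel: the right side runs over the sites from which [z] can be reached in
    one step. *)
Lemma Qop_delta w x z : ranged M w ->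
  Qop w (delta z) x = \sum_(k < M.*2.+1) w (nb M z k) z * delta (nb M z k) x.
Proof.
move=> wM; have [xz|xz] := leP `|z - x| M%:Z; last first.
  rewrite /Qop big1 ?big1// => k _; rewrite /delta; case: eqP => [e|_]; rewrite ?mulr0//.
    by move: xz; rewrite e ltNge nb_dist.
  by move: xz; rewrite -e distrC ltNge nb_dist.
have [k ke] := nbP xz.
have [k' ke'] : exists k' : 'I_(M.*2.+1), z = nb M x k' by apply: nbP; rewrite distrC.
rewrite /Qop (bigD1 k')//= [RHS](bigD1 k)//= -ke -ke' /delta !eqxx.
rewrite big1 ?big1// => i ik; case: eqP => [|_]; rewrite ?mulr0//.
  by rewrite {1}ke => /nb_inj/val_inj ki; rewrite ki eqxx in ik.
by rewrite {1}ke' => /nb_inj/val_inj ki; rewrite ki eqxx in ik.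
Qed.

Definition visits U j z : set walk :=
  [set X : walk | (forall i, (i <= j)%N -> U (X i)) /\ X j = z].

Lemma measurable_visits U j z : measurable (visits U j z).
Proof.
rewrite (_ : visits U j z = (\bigcap_(i in [set i | (i <= j)%N])
   \bigcup_(y : int) (if U y then [set X : walk | X i = y] else set0)) `&`
   [set X | X j = z]).
  apply: measurableI; last exact: measurable_walk_at.
  apply: bigcap_measurable => [|i _]; first by exists 0%N.
  apply: countable_bigcupT_measurable => // y.
  by case: ifP => // _; exact: measurable_walk_at.
apply/seteqP; split => X /= [H Xj]; split => // i ij.
  by exists (X i) => //; rewrite H.
by have [y _] := H i ij; case: ifP => // Uy /= ->.
Qed.

Lemma quenched_kst w U j z x : ranged M w ->
  quenched w x (visits U j z) = (kst w U j (delta z) x)%:E.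
Proof.
have mA i : measurable (visits U i z) by exact: measurable_visits.
move=> wM; elim: j x => [|j IH] x; rewrite (quenched_step _ wM)//=.
  rewrite (eq_bigr (fun k : 'I_(M.*2.+1) =>
    (w x (nb M x k) * (if U x then delta z x else 0))%:E)%E).
    by rewrite sumEFin -mulr_suml env_sum_nb ?mul1r.
  move=> k _; rewrite EFinM; congr (_ * _)%E.
  have [/andP[Ux /eqP xz]|H] := boolP (U x && (x == z)).
    rewrite -xz Ux /delta eqxx (_ : _ @^-1` _ = setT) ?probability_setT//.
    by apply/seteqP; split => // X _; split => //= i; rewrite leqn0 => /eqP->.
  rewrite (_ : _ @^-1` _ = set0) ?measure0.
    by move: H; rewrite negb_and /delta; case: (U x) => //= /negbTE ->.
  apply/seteqP; split => // X /= [/(_ 0%N isT)/= Ux xz].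
  by rewrite Ux xz eqxx in H.
rewrite (eq_bigr (fun k : 'I_(M.*2.+1) =>
    (w x (nb M x k) * (if U x then kst w U j (delta z) (nb M x k) else 0))%:E)%E).
  rewrite sumEFin; congr EFin; case: ifP => // _.
  by rewrite big1// => k _; rewrite mulr0.
move=> k _; rewrite EFinM; congr (_ * _)%E.
case: ifPn => Ux.
  rewrite -IH; congr (quenched _ _ _); apply/seteqP; split => X /= [H Xz]; split => //.
    by move=> i ij; have := H i.+1 ij.
  by move=> [|i] ij //=; exact: H.
rewrite (_ : _ @^-1` _ = set0) ?measure0//.
by apply/seteqP; split => // X /= [/(_ 0%N isT)/=]; rewrite (negbTE Ux).
Qed.

End operators.

(** * Oscillation of harmonic functions on half-lines *)

Definition upto (K : int) : pred int := fun y => y < K.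

Section harmonic.
Context {R : realType} (M : nat) (M1 : (1 <= M)%N) (kappa : R) (w : env R).
Hypotheses (k0 : 0 < kappa) (wM : ranged M w)
  (well : forall i j : int, `|i - j| <= M%:Z -> kappa < w i j)
  (wtrans : forall (K x : int) (e : R), 0 < e ->
     exists j, kst M w (upto K) j (fun=> 1) x < e).
Implicit Types (h : int -> R) (K x y z : int) (a b c m B e : R).

Let k1 : kappa < 1.
Proof. by rewrite (lt_le_trans _ (env_le1 w 0 0))// well// subrr normr0. Qed.

Let k20 : 0 < kappa ^+ 2. Proof. by rewrite exprn_gt0. Qed.

Let k21 : kappa ^+ 2 <= 1. Proof. by rewrite exprn_ile1// ltW. Qed.

Definition harm_below K h := forall x, x < K -> h x = Qop M w h x.

Lemma harm_belowN K h : harm_below K h -> harm_below K (fun x => - h x).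
Proof.
move=> hh x xK; rewrite hh// /Qop -sumrN; apply: eq_bigr => k _.
by rewrite mulrN.
Qed.

Lemma harm_belowW K K' h : K' <= K -> harm_below K h -> harm_below K' h.
Proof. by move=> KK hh x xK; apply: hh; exact: lt_le_trans KK. Qed.

Lemma nb_upto K x (k : 'I_(M.*2.+1)) : x < K -> nb M x k < K + M%:Z.
Proof. by have := nb_dist x k; lia. Qed.

(** Optional stopping at the exit from ]-oo, K[: steps of size at most [M] land in the block [K, K +
    M[, where [h] is at least [m], and the walk does not stay below [K] forever. *)
Lemma min_principle K h m B : harm_below K h -> (forall x, `|h x| <= B) ->
  (forall x, K <= x < K + M%:Z -> m <= h x) ->
  forall x, x < K + M%:Z -> m <= h x.
Proof.
move=> hh hB hm x xK.
set C := `|m| + B.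
have C0 : 0 <= C by rewrite addr_ge0// (le_trans _ (hB 0)).
have mC y : m - C <= h y.
  have := hB y; rewrite ler_norml => /andP[+ _]; apply: le_trans.
  by rewrite /C opprD addrA gerDr subr_le0 ler_norm.
(* On the event of still being below [K] after [j] steps, at most [C] is lost with respect to
   [m]. *)
have H j y : y < K + M%:Z -> m - C * kst M w (upto K) j (fun=> 1) y <= h y.
  elim: j y => [|j IH] y yK; have [Ky|Ky] := leP K y.
  - by rewrite kst_out ?mulr0 ?subr0 ?hm ?Ky// /upto -leNgt.
  - by rewrite /= /upto Ky mulr1.
  - by rewrite kst_out ?mulr0 ?subr0 ?hm ?Ky// /upto -leNgt.
  - rewrite kst_in// hh// -mulNr -Qop_affine//.
    by apply: Qop_le => k; rewrite mulNr IH// nb_upto.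
rewrite leNgt; apply/negP => hx.
(* [C + 1] and not [C], which may vanish. *)
have e0 : 0 < (m - h x) / (C + 1) by rewrite divr_gt0 ?subr_gt0// ltr_wpDl.
have [j je] := wtrans K x e0.
have := H j x xK; apply/negP; rewrite -ltNge.
have : C * kst M w (upto K) j (fun=> 1) x < m - h x; last by lra.
have s0 : 0 <= kst M w (upto K) j (fun=> 1) x by exact: kst_ge0.
apply: (@le_lt_trans _ _ ((C + 1) * kst M w (upto K) j (fun=> 1) x)).
  by rewrite ler_wpM2r// lerDl.
by rewrite mulrC -ltr_pdivlMr// ltr_wpDl.
Qed.

Lemma max_principle K h m B : harm_below K h -> (forall x, `|h x| <= B) ->
  (forall x, K <= x < K + M%:Z -> h x <= m) ->
  forall x, x < K + M%:Z -> h x <= m.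
Proof.
move=> hh hB hm x xK; rewrite -lerN2.
apply: (@min_principle K (fun x => - h x) _ B) => //; first exact: harm_belowN.
  by move=> y; rewrite normrN.
by move=> y yK; rewrite lerN2 hm.
Qed.

(* Two steps suffice to go from any site of the block [K-M, K[ to K through
   K-1, so the value at K is felt with weight kappa^2 on the whole block. *)
Lemma harm_step_up K h b c : harm_below K h -> (forall x, x < K + M%:Z -> h x <= b) ->
  h K <= b - c -> 0 <= c -> forall x, K - M%:Z <= x < K -> h x <= b - kappa ^+ 2 * c.
Proof.
move=> hh hb hK c0.
have one x y c' : x < K -> `|x - y| <= M%:Z -> 0 <= c' -> h y <= b - c' ->
    h x <= b - kappa * c'.
  move=> xK xy c'0 hy; rewrite hh//; have [k yk] := nbP xy.
  apply: (@le_trans _ _ (Qop M w (fun z => b + (- c') * delta y z) x)).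
    apply: Qop_le => i; rewrite /delta mulNr.
    case: eqP => [->|_]; first by rewrite mulr1.
    by rewrite mulr0 subr0 hb// nb_upto.
  rewrite Qop_affine// mulNr lerD2l lerN2 mulrC ler_wpM2l//.
  rewrite /Qop (bigD1 k)//= -yk /delta eqxx mulr1.
  rewrite (le_trans (ltW (well xy)))// lerDl sumr_ge0// => i _.
  by rewrite mulr_ge0 ?env_ge0.
move=> x /andP[Kx xK]; rewrite expr2 -mulrA.
apply: (one _ (K - 1)) => //; [lia|by rewrite mulr_ge0// ltW|].
apply: (one _ K) => //; lia.
Qed.

(** According to the side of the midpoint on which [h K] lies, the upper or the lower bound
    improves. The gap [(b - a) / 2] at [K] is felt with weight [kappa ^+ 2] on the block left of
    [K], whence the factor [1 - kappa ^+ 2 / 2]; the maximum or minimum principle below [K - M]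
    carries the improved bound to everything left of the block. *)
Lemma osc_step K h a b B : harm_below K h -> (forall x, `|h x| <= B) ->
  (forall x, x < K + M%:Z -> a <= h x <= b) ->
  exists a' b', [/\ a <= a', b' <= b, b' - a' <= (1 - kappa ^+ 2 / 2) * (b - a) &
    forall x, x < K -> a' <= h x <= b'].
Proof.
move=> hh hB hab.
have /andP[aK Kb] := hab K ltac:(lia).
have k2 : 0 <= kappa ^+ 2 by rewrite exprn_ge0// ltW.
have hKK : harm_below (K - M%:Z) h by apply: harm_belowW hh; lia.
have [hK|hK] := leP (h K) ((a + b) / 2).
  exists a, (b - kappa ^+ 2 * ((b - a) / 2)).
  split => //; [by rewrite gerBl mulr_ge0//; lra|lra|].
  move=> x xK; apply/andP; split; first by have /andP[] := hab x ltac:(lia).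
  apply: (max_principle hKK hB); last by lia.
  move=> y yK; apply: (harm_step_up hh) => //; [|lra|lra|lia].
  by move=> z /hab/andP[].
exists (a + kappa ^+ 2 * ((b - a) / 2)), b.
split => //; [by rewrite lerDl mulr_ge0//; lra|lra|].
move=> x xK; apply/andP; split; last by have /andP[] := hab x ltac:(lia).
apply: (min_principle hKK hB); last by lia.
move=> y yK; rewrite -lerN2 opprD.
apply: (harm_step_up (harm_belowN hh)) => //; [|lra|lra|lia].
by move=> z /hab/andP[az _]; rewrite lerN2.
Qed.

Lemma osc_iter K h a b B n : harm_below K h -> (forall x, `|h x| <= B) ->
  (forall x, x < K + M%:Z -> a <= h x <= b) ->
  exists a' b', [/\ a <= a', b' <= b, b' - a' <= (1 - kappa ^+ 2 / 2) ^+ n * (b - a) &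
    forall x, x < K + M%:Z - (n * M)%N%:Z -> a' <= h x <= b'].
Proof.
move=> hh hB hab; elim: n => [|n [a1 [b1 [aa bb ba hn]]]].
  by exists a, b; rewrite expr0 mul1r mul0n subr0.
have [|||a' [b' [aa' bb' ba' hn']]] := @osc_step (K - (n * M)%N%:Z) h a1 b1 B => //.
- by apply: harm_belowW hh; lia.
- by move=> x xK; apply: hn; lia.
exists a', b'; split; [exact: le_trans aa'|exact: le_trans bb| |].
  rewrite (le_trans ba')// [_ ^+ n.+1]exprS -mulrA ler_wpM2l//.
  by move: k20 k21; lra.
by move=> x xK; apply: hn'; move: xK; rewrite mulSn PoszD; clear; lia.
Qed.

Lemma theta_small (C e : R) : 0 < e -> exists n, (1 - kappa ^+ 2 / 2) ^+ n * C <= e.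
Proof.
move=> e0; set t := 1 - _.
have t1 : `|t| < 1 by rewrite ltr_norml /t; move: k20 k21; lra.
have : t ^+ n * C @[n --> \oo] --> (0 : R).
  by rewrite -(mul0r C); apply: cvgMr_tmp; exact: cvg_expr.
move=> /cvgrPdist_le/(_ e e0)[n _ /(_ n (leqnn n))]; rewrite sub0r normrN => H.
by exists n; rewrite (le_trans (ler_norm _)).
Qed.

Lemma liouville h B : (forall x, h x = Qop M w h x) -> (forall x, `|h x| <= B) ->
  forall x y, h x = h y.
Proof.
move=> hh hB.
suff H x y : h x <= h y by move=> x y; apply/eqP; rewrite eq_le !H.
rewrite -subr_le0; apply/ler_addgt0Pl => e e0; rewrite addr0.
have [n ne] := theta_small (B - (- B)) e0.
(* So far to the right that [x] and [y] still lie to the left after [n] contractions. *)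
pose K := `|x| + `|y| + 1 + (n * M)%N%:Z.
have [|||a' [b' [_ _ ab hab]]] := @osc_iter K h (- B) B B n => //.
  by move=> z _; rewrite -ler_norml.
have /andP[_ hx] := hab x ltac:(rewrite /K; lia).
have /andP[hy _] := hab y ltac:(rewrite /K; lia).
by lra.
Qed.

(** The oscillation over ]-oo, y0[ tends to 0 as [y0] goes to -oo. This makes the sequence Cauchy
    and its limit the same for every offset [z]. *)
Lemma left_limit h K a b B : harm_below K h -> (forall x, `|h x| <= B) ->
  (forall x, K <= x < K + M%:Z -> a <= h x <= b) ->
  exists2 l, a <= l <= b & forall z : int, h (z - n%:Z) @[n --> \oo] --> l.
Proof.
move=> hh hB hab.
have hab' x : x < K + M%:Z -> a <= h x <= b.
  move=> xK; rewrite (min_principle hh hB) ?(max_principle hh hB)// => y.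
    by move=> /hab/andP[].
  by move=> /hab/andP[].
have H e : 0 < e -> exists y0, forall x y, x < y0 -> y < y0 -> `|h x - h y| <= e.
  move=> e0; have [n ne] := theta_small (b - a) e0.
  have [a' [b' [_ _ ab H]]] := osc_iter n hh hB hab'.
  exists (K + M%:Z - (n * M)%N%:Z) => x y /H/andP[ax xb] /H/andP[ay yb].
  by rewrite ler_norml; apply/andP; split; lra.
have c0 : cvgn (fun n : nat => h (0 - n%:Z)).
  apply/cauchy_cvgP/cauchy_ballP => e e0.
  have [y0 y0P] := H (e / 2) ltac:(lra).
  pose N := [set n : nat | (`|y0| < n%:Z)].
  have NN : ((fun n : nat => h (0 - n%:Z)) @ \oo) ((fun n : nat => h (0 - n%:Z)) @` N).
    by exists `|y0|%N.+1 => // n /= yn; exists n => //; rewrite /N /=; lia.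
  exists ((fun n : nat => h (0 - n%:Z)) @` N, (fun n : nat => h (0 - n%:Z)) @` N) => //.
  move=> [_ _] /= [[i iy <-] [j jy <-]]; rewrite /ball/= (le_lt_trans (y0P _ _ _ _))//.
  - by move: iy; rewrite /N /=; lia.
  - by move: jy; rewrite /N /=; lia.
  - by lra.
exists (limn (fun n : nat => h (0 - n%:Z))).
  have ev : \forall n \near \oo, a <= h (0 - n%:Z) <= b.
    by exists (`|K|)%N.+1 => // n /= nK; apply: hab'; lia.
  rewrite limr_ge ?limr_le//; apply: filterS ev => n /andP[]//.
move=> z; apply/cvgrPdist_le => e e0.
have [y0 y0P] := H (e / 2) ltac:(lra).
move/cvgrPdist_le: c0 => /(_ (e / 2) ltac:(lra)) [N _ HN].
exists (maxn N (`|y0| + `|z|)%N.+1) => // n /=; rewrite geq_max => /andP[Nn yn].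
have := HN n Nn; have := y0P (0 - n%:Z) (z - n%:Z) ltac:(lia) ltac:(lia).
rewrite !ler_norml => /andP[? ?] /andP[? ?]; apply/andP; split; lra.
Qed.

End harmonic.

(** * The Green function *)

Section green.
Context {R : realType} (M : nat).
Implicit Types (w : env R) (y z : int) (n : nat).

Definition greenn w n y z : R := \sum_(j < n) kst M w predT j (delta z) y.

Definition green w y z : R := limn (fun n => greenn w n y z).

Lemma greenn_nd w y z : nondecreasing_seq (fun n => greenn w n y z).
Proof.
apply/nondecreasing_seqP => n; rewrite /greenn big_ord_recr/= lerDl.
by apply: kst_ge0 => u _; exact: delta_ge0.
Qed.

Lemma greenn_ge0 w n y z : 0 <= greenn w n y z.
Proof. by apply: sumr_ge0 => j _; apply: kst_ge0 => u _; exact: delta_ge0. Qed.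

Lemma greennSl w n y z :
  greenn w n.+1 y z = delta z y + Qop M w (fun u => greenn w n u z) y.
Proof.
rewrite /greenn big_ord_recl/=; congr (_ + _).
rewrite [RHS](_ : _ = Qop M w (fun u => \sum_(j < n) 1 * kst M w predT j (delta z) u) y).
  by rewrite Qop_sum; apply: eq_bigr => j _; rewrite mul1r.
by apply: eq_Qop => k; apply: eq_bigr => j _; rewrite mul1r.
Qed.

(** Decomposition at the last step. The starting point [y] is a mere parameter here, so it can be
    sent to -oo, which leaves an invariance equation in [z]. *)
Lemma greennSr w n y z : ranged M w ->
  greenn w n.+1 y z = delta z y + \sum_(k < M.*2.+1) greenn w n y (nb M z k) * w (nb M z k) z.
Proof.
move=> wM; rewrite /greenn big_ord_recl/=; congr (_ + _).
under [RHS]eq_bigr do rewrite mulr_suml.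
rewrite [RHS]exchange_big/=; apply: eq_bigr => j _.
transitivity (kst M w predT j.+1 (delta z) y) => //.
rewrite kstSr (eq_kst _ _ _ _ (psi := fun x =>
  \sum_(k < M.*2.+1) w (nb M z k) z * delta (nb M z k) x)); last first.
  by move=> u _; rewrite -Qop_delta.
by rewrite kst_sum; apply: eq_bigr => k _; rewrite mulrC.
Qed.

(** Nothing is counted before the first visit to [z]: away from [z] one step averages values that
    are bounded by the diagonal one by induction. *)
Lemma greenn_le_diag w n y z : ranged M w -> greenn w n y z <= greenn w n z z.
Proof.
move=> wM; elim: n y => [|n IH] y; first by rewrite /greenn !big_ord0.
have [->//|yz] := eqVneq y z.
rewrite greennSl /delta (negbTE yz) add0r (le_trans _ (greenn_nd w z z (leqnSn n)))//.
exact: Qop_le_cst.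
Qed.

Lemma greenn_shift w z n x y : greenn (env_shift z w) n x y = greenn w n (z + x) (z + y).
Proof.
apply: eq_bigr => j _; rewrite kst_shift; apply: eq_kst => u _.
by rewrite /delta subr_eq addrC.
Qed.

Lemma measurable_greenn n y z : measurable_fun [set: env R] (fun w => greenn w n y z).
Proof. by apply: measurable_sum => j; exact: measurable_kst. Qed.

Section recurrence.
Variable w : env R.
Hypotheses (wM : ranged M w)
  (gfin : forall z, exists C, forall n, greenn w n z z <= C).

Lemma cvg_greenn y z : greenn w n y z @[n --> \oo] --> green w y z.
Proof.
have [C gC] := gfin z.
apply: nondecreasing_is_cvgn; first exact: greenn_nd.
by exists C => _ [n _ <-]; exact: le_trans (greenn_le_diag _ _ _ wM) (gC n).
Qed.

Lemma cvg_greennS y z : greenn w n.+1 y z @[n --> \oo] --> green w y z.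
Proof. by have := @cvg_greenn y z; rewrite -cvg_shiftS. Qed.

Lemma greenn_le_green n y z : greenn w n y z <= green w y z.
Proof.
apply: nondecreasing_cvgn_le; first exact: greenn_nd.
by apply/cvg_ex; exists (green w y z); exact: cvg_greenn.
Qed.

Lemma green_ge0 y z : 0 <= green w y z.
Proof. exact: le_trans (greenn_ge0 w 0 y z) (greenn_le_green _ _ _). Qed.

Lemma green_le_diag y z : green w y z <= green w z z.
Proof.
apply: ler_cvg_to (@cvg_greenn y z) (@cvg_greenn z z) _.
by apply: nearW => n; exact: greenn_le_diag.
Qed.

Lemma greenSl y z : green w y z = delta z y + Qop M w (fun u => green w u z) y.
Proof.
have H : greenn w n.+1 y z @[n --> \oo] --> delta z y + Qop M w (fun u => green w u z) y.
  under eq_fun do rewrite greennSl.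
  apply: cvgD; first exact: cvg_cst.
  apply: cvg_big => [|k _]; first exact: add_continuous.
   apply: cvgMl_tmp; exact: cvg_greenn.
exact: (cvg_unique _ (@cvg_greennS y z) H).
Qed.

Lemma greenSr y z :
  green w y z = delta z y + \sum_(k < M.*2.+1) green w y (nb M z k) * w (nb M z k) z.
Proof.
have H : greenn w n.+1 y z @[n --> \oo] -->
    delta z y + \sum_(k < M.*2.+1) green w y (nb M z k) * w (nb M z k) z.
  under eq_fun do rewrite greennSr//.
  apply: cvgD; first exact: cvg_cst.
  apply: cvg_big => [|k _]; first exact: add_continuous.
   apply: cvgMr_tmp; exact: cvg_greenn.
exact: (cvg_unique _ (@cvg_greennS y z) H).
Qed.

End recurrence.

Section left_limit.
Hypothesis M1 : (1 <= M)%N.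
Variables (kappa : R) (w : env R).
Hypotheses (k0 : 0 < kappa) (wM : ranged M w)
  (well : forall i j : int, `|i - j| <= M%:Z -> kappa < w i j)
  (wtrans : forall (K x : int) (e : R), 0 < e ->
     exists j, kst M w (upto K) j (fun=> 1) x < e)
  (gfin : forall z, exists C, forall n, greenn w n z z <= C).

Definition green_left z : R := limn (fun n : nat => green w (- n%:Z) z).

(** [green w y z] is harmonic in [y] below [z]. The boundary block is taken to be [z - M, z[, from
    which [z] is reached in one step with probability above [kappa]; as the diagonal value is at
    least 1, this gives the lower bound. *)
Lemma green_left_ex z : exists2 l, kappa <= l <= green w z z &
  forall y, green w (y - n%:Z) z @[n --> \oo] --> l.
Proof.
apply: (@left_limit R M M1 kappa w k0 wM well wtrans (fun y => green w y z)
  (z - M%:Z) _ _ (green w z z)).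
- move=> x xz; rewrite greenSl//= /delta.
  by case: eqP => [e|_]; rewrite ?add0r//; move: xz; rewrite e; lia.
- by move=> x; rewrite ger0_norm ?green_ge0 ?green_le_diag.
- move=> x xz; rewrite green_le_diag// andbT.
  have xz' : `|x - z| <= M%:Z by lia.
  rewrite (le_trans (ltW (well xz')))//; have [k zk] := nbP xz'.
  rewrite greenSl// ler_wpDl ?delta_ge0// /Qop (bigD1 k)//= -zk.
  rewrite ler_wpDr//; first by rewrite sumr_ge0// => i _; rewrite mulr_ge0 ?env_ge0 ?green_ge0.
  rewrite ler_peMr ?env_ge0// greenSl// /delta eqxx lerDl.
  by apply: Qop_ge0 => u; exact: green_ge0.
Qed.

Lemma cvg_green_left y z : green w (y - n%:Z) z @[n --> \oo] --> green_left z.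
Proof.
have [l _ H] := green_left_ex z; rewrite /green_left.
have := H 0; under eq_fun do rewrite sub0r.
by move=> /(cvg_lim (@Rhausdorff _)) ->; exact: H.
Qed.

Lemma green_left_bound z : kappa <= green_left z <= green w z z.
Proof.
have [l lb H] := green_left_ex z.
by rewrite (cvg_unique _ (@cvg_green_left 0 z) (H 0)).
Qed.

Lemma green_left_inv z :
  green_left z = \sum_(k < M.*2.+1) green_left (nb M z k) * w (nb M z k) z.
Proof.
(* Starting points to the left of [z] never equal it, so the delta term of [greenSr] vanishes for
   every [n]. *)
have H : green w (z - 1 - n%:Z) z @[n --> \oo] -->
    \sum_(k < M.*2.+1) green_left (nb M z k) * w (nb M z k) z.
  rewrite (_ : (fun n => _) = (fun n : nat =>
    \sum_(k < M.*2.+1) green w (z - 1 - n%:Z) (nb M z k) * w (nb M z k) z)).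
    apply: cvg_big => [|k _]; first exact: add_continuous.
    by apply: cvgMr_tmp; exact: cvg_green_left.
  apply/funext => n; rewrite greenSr// /delta.
  by case: eqP => [e|_]; [clear -e; lia|rewrite add0r].
exact: (cvg_unique _ (@cvg_green_left _ z) H).
Qed.

End left_limit.
End green.

(** * Kalikow's condition *)

Section drift.
Context {R : realType} (M : nat).
Implicit Types (w : env R) (x z : int).

(* Unlike [drift], this finite sum is bounded on all of [env R], not only on the
   environments of range M. *)
Definition fdrift w z : R :=
  \sum_(k < M.*2.+1) (k%:Z - M%:Z)%:~R * w z (nb M z k).

Definition fdrift_bd : R := (M.*2.+1 * M)%N%:R.

Lemma fdrift_le w z : `|fdrift w z| <= fdrift_bd.
Proof.
rewrite (le_trans (ler_norm_sum _ _ _))// /fdrift_bd natrM mulr_natl.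
rewrite -[leRHS](_ : \sum_(k < M.*2.+1) M%:R = _); last by rewrite sumr_const card_ord.
apply: ler_sum => k _; rewrite normrM (ger0_norm (env_ge0 _ _ _)) -[leRHS]mulr1.
rewrite ler_pM ?env_ge0 ?env_le1// -intr_norm -[M%:R]/(M%:Z%:~R) ler_int.
by have := ltn_ord k; lia.
Qed.

Lemma measurable_fdrift z : measurable_fun [set: env R] (fun w => fdrift w z).
Proof.
by apply: measurable_sum => k; apply: measurable_funM => //; exact: measurable_env_at.
Qed.

Lemma drift_shiftE w z : ranged M w -> drift (env_shift z w) = fdrift w z.
Proof.
move=> wM; rewrite /drift.
pose f (i : int) : R := i%:~R * w z (z + i).
rewrite (_ : (fun i : int => (i%:~R * env_shift z w 0 i)%:E) = EFin \o f); last first.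
  by apply/funext => i; rewrite /f/= addr0.
have fM i : `|0 - i| > M%:Z -> f i = 0.
  by move=> iM; rewrite /f wM ?mulr0//; move: iM; clear; lia.
rewrite (@esum_nb _ M 0 ((EFin \o f)^\+)%E) => [||i iM]; last 2 first.
- by move=> i; rewrite funepos_ge0.
- by rewrite funeposE/= fM// maxxx.
rewrite (@esum_nb _ M 0 ((EFin \o f)^\-)%E) => [||i iM]; last 2 first.
- by move=> i; rewrite funeneg_ge0.
- by rewrite funenegE/= fM// oppr0 maxxx.
under eq_bigr do rewrite funeposE/= -EFin_max.
under [X in (_ - X)%E]eq_bigr do rewrite funenegE/= -EFin_max.
rewrite !sumEFin -EFinB/= -sumrB; apply: eq_bigr => k _.
rewrite /f /nb add0r.
set r := _ * _; case: (leP r 0) => [r0|r0].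
  by rewrite max_l ?oppr_ge0// sub0r opprK.
by rewrite max_r ?subr0// oppr_le0 ltW.
Qed.

Lemma esum_int (f : int -> \bar R) : (forall i, 0 <= f i)%E ->
  (\esum_(i in [set: int]) f i =
   \sum_(n <oo) f (Posz n) + \sum_(n <oo) f (Negz n))%E.
Proof.
move=> f0; rewrite (esumID (range Posz))// !setTI.
rewrite (_ : ~` _ = range Negz); last first.
  apply/seteqP; split => [[n|n]|_ [n _ <-]] //=; last by case.
    by move=> /(_ (ex_intro2 _ _ n Logic.I erefl)).
  by move=> _; exists n.
rewrite !esum_image; [|by move=> i j _ _ []..].
by rewrite !nneseries_esumT.
Qed.

Lemma measurable_drift : measurable_fun [set: env R] (@drift R).
Proof.
apply: (measurableT_comp (measurable_funTS (@fine_measurable R setT measurableT))) => //.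
have mf i : measurable_fun [set: env R] (fun w => (i%:~R * w 0 i)%:E : \bar R).
  apply/measurable_EFinP; apply: measurable_funM => //; exact: measurable_env_at.
apply: emeasurable_funB.
  under eq_fun do rewrite esum_int//.
  apply: emeasurable_funD; apply: ge0_emeasurable_sum => // n _;
    under eq_fun do rewrite funeposE; apply: measurable_maxe => //; exact: mf.
under eq_fun do rewrite esum_int//.
apply: emeasurable_funD; apply: ge0_emeasurable_sum => // n _;
  under eq_fun do rewrite funenegE; apply: measurable_maxe => //;
  apply: measurableT_comp => //; exact: mf.
Qed.

End drift.

(** * The exponential Lyapunov function *)

Section supermartingale.
Context {R : realType} (M : nat).
Implicit Types (w : env R) (x z : int).

(** Dynkin's formula as an inequality: the sum telescopes up to the values of [phi] outside [U], and
    dropping these nonnegative values at each exit only helps. *)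
Lemma kst_supermartingale w U n (phi : int -> R) x : (forall y, 0 <= phi y) ->
  \sum_(j < n) kst M w U j (fun y => phi y - Qop M w phi y) x <= phi x.
Proof.
move=> p0; apply: (@le_trans _ _ (kst M w U 0 phi x - kst M w U n phi x)).
  elim: n => [|n IH]; first by rewrite big_ord0 subrr.
  rewrite big_ord_recr/= kstB.
  rewrite [leRHS](_ : _ = (kst M w U 0 phi x - kst M w U n phi x) +
     (kst M w U n phi x - kst M w U n.+1 phi x)); last by rewrite addrA subrK.
  apply: lerD => //; rewrite lerD2l lerN2 kstSr.
  by apply: kst_le => y _; apply: Qop_le => k; case: ifP => _; rewrite ?lexx ?p0.
rewrite (@le_trans _ _ (kst M w U 0 phi x))//.
  by rewrite gerBl kst_ge0.
by rewrite /=; case: ifP => _; rewrite ?lexx ?p0.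
Qed.

(** Inverting [1 - u <= expR (- u)] leaves [1 / (1 - u)], and [(1 - u) * (1 + u + 2 * u ^+ 2) = 1 +
    u ^+ 2 - 2 * u ^+ 3] is at least 1 exactly because [u <= 1 / 2]. *)
Lemma expR_le_quad (u : R) : `|u| <= 1 / 2 -> expR u <= 1 + u + 2 * u ^+ 2.
Proof.
rewrite ler_norml => /andP[u1 u2].
have e1 : 1 - u <= expR (- u) by have := expR_ge1Dx (- u).
have u10 : 0 < 1 - u by lra.
rewrite -[u in expR u]opprK expRN -[leRHS]invrK lef_pV2 ?posrE ?expR_gt0 ?invr_gt0//; last by nra.
rewrite (le_trans _ e1)// -[leRHS]invrK lef_pV2 ?posrE ?invr_gt0//; last by nra.
rewrite -[leLHS]mul1r ler_pdivrMr//.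
by nra.
Qed.

(** Expanding the exponential over one step: the linear term is the local drift, and the quadratic
    one is bounded by its value at the maximal displacement [M]. *)
Lemma exp_lyapunov w z (lam : R) : ranged M w -> 0 < lam -> lam * M%:R <= 1 / 2 ->
  expR (- (lam * z%:~R)) * (lam * fdrift M w z - 2 * (lam * M%:R) ^+ 2) <=
  expR (- (lam * z%:~R)) - Qop M w (fun y => expR (- (lam * y%:~R))) z.
Proof.
move=> wM l0 lM.
rewrite lerBrDr -lerBrDl -[X in _ <= X - _]mulr1 -mulrBr.
have -> : Qop M w (fun y => expR (- (lam * y%:~R))) z = expR (- (lam * z%:~R)) *
    \sum_(k < M.*2.+1) w z (nb M z k) * expR (- (lam * (k%:Z - M%:Z)%:~R)).
  rewrite mulr_sumr; apply: eq_bigr => k _.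
  by rewrite /nb intrD mulrDr opprD expRD mulrCA.
rewrite ler_wpM2l ?expR_ge0//.
apply: (@le_trans _ _ (\sum_(k < M.*2.+1) w z (nb M z k) *
   (1 - lam * (k%:Z - M%:Z)%:~R + 2 * (lam * M%:R) ^+ 2))).
  apply: ler_sum => k _; rewrite ler_wpM2l ?env_ge0//.
  have kM : `|(k%:Z - M%:Z)%:~R : R| <= M%:R.
    rewrite -intr_norm -[M%:R]/(M%:Z%:~R) ler_int.
    by have := ltn_ord k; lia.
  have lk : `|- (lam * (k%:Z - M%:Z)%:~R)| <= lam * M%:R.
    by rewrite normrN normrM (gtr0_norm l0) ler_wpM2l// ltW.
  rewrite (le_trans (expR_le_quad _)) ?(le_trans lk)// lerD2l ler_wpM2l//.
  by rewrite -[leLHS]real_normK ?num_real// lerXn2r ?nnegrE ?mulr_ge0// ltW.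
under eq_bigr do rewrite -addrA mulrDr mulr1 addrC mulrDr.
rewrite 2!big_split/= env_sum_nb// -mulr_suml env_sum_nb// mul1r.
rewrite (_ : \sum_(i < _) _ = - (lam * fdrift M w z)); first by lra.
rewrite /fdrift mulr_sumr -sumrN; apply: eq_bigr => k _.
by rewrite mulrN mulrCA [_ * w _ _]mulrC.
Qed.

End supermartingale.

Section ereal_facts.
Context {R : realType}.
Local Open Scope ereal_scope.

(** The factor may have either sign, here and in the integral version below: it will be a local
    drift. *)
Lemma nneseriesZl_real (d : R) (f : nat -> \bar R) : (forall n, 0 <= f n) ->
  \sum_(n <oo) d%:E * f n = d%:E * \sum_(n <oo) f n.
Proof.
move=> f0; apply/cvg_lim => //.
rewrite (_ : (fun n => _) = (fun n => d%:E * \sum_(0 <= k < n) f k)); last first.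
  by apply/funext => n; rewrite ge0_sume_distrr.
by apply: cvgeZl => //; exact: is_cvg_nneseries.
Qed.

Lemma ge0_integralZl_real d (T : measurableType d) (mu : {measure set T -> \bar R})
    (c : R) (f : T -> \bar R) : measurable_fun setT f -> (forall x, 0 <= f x) ->
  \int[mu]_x (c%:E * f x) = c%:E * \int[mu]_x f x.
Proof.
move=> mf f0; have [c0|c0] := leP 0%R c; first by rewrite ge0_integralZl_EFin.
rewrite (_ : (fun x => _) = (fun x => - ((- c)%:E * f x))); last first.
  by apply/funext => x; rewrite EFinN mulNe oppeK.
have c0' : (0 <= - c)%R by rewrite oppr_ge0 ltW.
rewrite integral_ge0N ?ge0_integralZl_EFin//; first by rewrite EFinN mulNe oppeK.
by move=> x _; rewrite mule_ge0.
Qed.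

Lemma ae_prob1 d (T : measurableType d) (P : probability T R) (A : set T) :
  measurable A -> P A = 1 -> \forall x \ae P, A x.
Proof.
move=> mA PA; exists (~` A); split => //; first exact: measurableC.
by rewrite probability_setC// PA subee.
Qed.

End ereal_facts.

(** * Kalikow's quotient in terms of mean numbers of visits *)

Section kalikow_series.
Context {R : realType}.
Implicit Types (w : env R) (x z : int) (U : pred int) (X : walk).

(** The sum in Kalikow's condition includes the exit time itself. At that time the walk is outside
    [U] and cannot be at [x], so only times whose whole past lies in [U] count. *)
Lemma exit_time_visits U x X j : U x ->
  (j%:R%:E <= exit_time R [set y | U y] X)%E && (X j == x) = `[< visits U j x X >].
Proof.
move=> Ux; apply/idP/asboolP => [/andP[jT /eqP Xj]|[XU Xj]].
  split => // i ij; apply: contrapT => nU.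
  have : (j%:R%:E <= (i%:R : R)%:E)%E by apply: (le_trans jT); apply: ereal_inf_lbound; exists i.
  rewrite lee_fin ler_nat => ji; have e : i = j by apply/eqP; rewrite eqn_leq ij ji.
  by apply: nU; rewrite e Xj.
rewrite Xj eqxx andbT; apply: le_ereal_inf_tmp => _ [n nU <-].
rewrite lee_fin ler_nat leqNgt; apply/negP => nj; apply: nU; exact: XU (ltnW nj).
Qed.

Lemma visits_series U x X (c : int -> R) : U x ->
  (\sum_(0 <= j <oo | (j%:R%:E <= exit_time R [set y | U y] X)%E)
     ((X j == x)%:R * c (X j))%:E =
   (c x)%:E * \sum_(j <oo) (\1_(visits U j x) X)%:E)%E.
Proof.
move=> Ux; rewrite eseries_mkcond -nneseriesZl_real; last first.
  by move=> n; rewrite lee_fin.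
apply: eq_eseriesr => j _; rewrite indicE.
have := exit_time_visits X j Ux; rewrite -[X \in _]/(`[< visits U j x X >]) => <-.
case: ifP => _ /=; last by rewrite mule0.
case: eqP => [->|_]; first by rewrite mul1r mule1.
by rewrite mul0r mule0.
Qed.

Definition visit_mean w U x : \bar R := (\sum_(j <oo) quenched w 0 (visits U j x))%E.

Lemma visit_mean_ge0 w U x : (0 <= visit_mean w U x)%E.
Proof. by apply: nneseries_ge0 => j _ _; exact: measure_ge0. Qed.

Lemma measurable_visit_mean U x : measurable_fun [set: env R] (fun w => visit_mean w U x).
Proof.
apply: ge0_emeasurable_sum => // j _; apply: measurable_quenched.
exact: measurable_visits.
Qed.

Lemma visit_meanE w U x :
  (\int[quenched w 0]_X (\sum_(j <oo) (\1_(visits U j x) X)%:E) = visit_mean w U x)%E.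
Proof.
rewrite integral_nneseries//=; last first.
  by move=> n; apply/measurable_EFinP; apply: measurable_indic; exact: measurable_visits.
apply: eq_eseriesr => j _; rewrite integral_indic ?setIT//; exact: measurable_visits.
Qed.

Variable P : probability (env R) R.

Lemma kalikow_denE U x : U x ->
  kalikow_den P [set y | U y] x = (\int[P]_w visit_mean w U x)%E.
Proof.
move=> Ux; rewrite /kalikow_den /annealed_mean; apply: eq_integral => w _.
rewrite -visit_meanE; apply: eq_integral => X _ /=.
rewrite -[RHS]mul1e -(visits_series X (fun=> 1) Ux).
by apply: eq_eseriesr => j _; rewrite mulr1.
Qed.

(** At a visit to [x] the shifted drift depends on the environment alone, so it leaves the quenched
    expectation. *)
Lemma kalikow_numE U x : U x -> kalikow_num P [set y | U y] x =
  (\int[P]_w ((drift (env_shift x w))%:E * visit_mean w U x))%E.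
Proof.
move=> Ux; rewrite /kalikow_num /annealed_mean; apply: eq_integral => w _.
rewrite -visit_meanE -ge0_integralZl_real; last 2 first.
- apply: ge0_emeasurable_sum => // j _.
  by apply/measurable_EFinP; apply: measurable_indic; exact: measurable_visits.
- by move=> X; apply: nneseries_ge0 => j _ _; rewrite lee_fin.
apply: eq_integral => X _ /=.
exact: (visits_series X (fun y => drift (env_shift y w)) Ux).
Qed.

End kalikow_series.

Definition itv (N1 N2 : nat) : pred int := fun y => - N1%:Z <= y <= N2%:Z.

Lemma itv_connected M N1 N2 : (1 <= M)%N -> M_connected M [set y | itv N1 N2 y].
Proof.
move=> M1; exists (- N1%:Z), [seq - N1%:Z + i%:Z | i <- iota 1 (N1 + N2)]; split.
  have H n a : path (fun a b : int => `|a - b| <= M%:Z) (- N1%:Z + a%:Z)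
      [seq - N1%:Z + i%:Z | i <- iota a.+1 n].
    elim: n a => [|n IH] a //=; rewrite IH andbT; lia.
  by have := H (N1 + N2)%N 0%N; rewrite addr0.
apply/seteqP; split => y; rewrite /itv /= in_cons.
  move=> /andP[y1 y2]; case: eqP => //= yN.
  by apply/mapP; exists (absz (y + N1%:Z)); [rewrite mem_iota; lia|lia].
by case: eqP => [->|_] /=; [lia|move=> /mapP[i]; rewrite mem_iota; lia].
Qed.

Lemma finite_itv N1 N2 : finite_set [set y | itv N1 N2 y].
Proof.
apply: (@sub_finite_set _ _ ((fun k : nat => k%:Z - N1%:Z) @` `I_(N1 + N2).+1)).
  move=> y; rewrite /itv/= => /andP[y1 y2]; exists (absz (y + N1%:Z)); [|lia].
  by rewrite /=; lia.
exact/finite_image/finite_II.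
Qed.

Lemma kalikow_itv (R : realType) (P : probability (env R) R) M :
  (1 <= M)%N -> kalikow P M ->
  exists2 e : R, 0 < e & forall N1 N2 x, itv N1 N2 x ->
    (\int[P]_w visit_mean w (itv N1 N2) x < +oo)%E /\
    (e%:E * \int[P]_w visit_mean w (itv N1 N2) x <=
     \int[P]_w ((drift (env_shift x w))%:E * visit_mean w (itv N1 N2) x))%E.
Proof.
move=> M1 [_]; set I := ereal_inf _ => I0.
have [e e0 eI] : exists2 e : R, 0 < e & (e%:E <= I)%E.
  case: I I0 => [r|_|//]; first by rewrite lte_fin; exists r.
  by exists 1 => //; rewrite leey.
exists e => // N1 N2 x Ux.
have : (e%:E <= kalikow_num P [set y | itv N1 N2 y] x /
                kalikow_den P [set y | itv N1 N2 y] x)%E.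
  apply: (le_trans eI).
  apply: (@le_trans _ _ (ereal_inf [set (kalikow_num P [set y | itv N1 N2 y] x /
      kalikow_den P [set y | itv N1 N2 y] x)%E | x in [set y | itv N1 N2 y]])).
    apply: ereal_inf_lbound; exists [set y | itv N1 N2 y] => //.
    by split; [exact: finite_itv|exact: itv_connected|rewrite /itv /=; lia].
  by apply: ereal_inf_lbound; exists x.
rewrite kalikow_denE// kalikow_numE//.
set n := (\int[P]_w (_ * _))%E; set d := (\int[P]_w _)%E.
have : (0 <= d)%E by apply: integral_ge0 => w _; exact: visit_mean_ge0.
(* An infinite denominator has inverse 0 and would make the quotient 0, below [e]: finiteness of the
   mean number of visits is contained in the condition. *)
case: d => [r||//]; last first.
  by rewrite invey mule0 lee_fin => _ H; have := lt_le_trans e0 H; rewrite ltxx.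
rewrite lee_fin le_eqVlt => /orP[/eqP<-|r0].
  (* A zero denominator has inverse [+oo]. A negative numerator would then give [-oo], so the
     numerator is nonnegative, which is the claim in this case. *)
  rewrite inve0 mule0 => H; split; first exact: ltry.
  rewrite leNgt; apply/negP => n0; move: H.
  by rewrite lt0_muley// leeNy_eq.
by rewrite inver gt_eqF// lee_pdivlMr// => H; rewrite ltry.
Qed.

Section kalikow_estimate.
Context {R : realType} (M : nat).
Implicit Types (w : env R).

Lemma measurable_forall_int d (T : measurableType d) (F : int -> set T) :
  (forall i, measurable (F i)) -> measurable [set t | forall i, F i t].
Proof.
move=> mF; rewrite (_ : [set t | _] = ~` \bigcup_i ~` F i).
  apply: measurableC; apply: countable_bigcupT_measurable => // i; exact: measurableC.
by rewrite setC_bigcup; apply/seteqP; split => t /= H i; [move=> _; rewrite setCK|have := H i I; rewrite setCK].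
Qed.

Lemma measurable_ranged : measurable [set w : env R | ranged M w].
Proof.
apply: measurable_forall_int => i; apply: measurable_forall_int => j.
have [ij|ij] := pselect (`|i - j| > M%:Z); last first.
  have -> : (fun w : env R => `|i - j| > M%:Z -> w i j = 0) = setT by apply/seteqP; split.
  exact: measurableT.
have -> : (fun w : env R => `|i - j| > M%:Z -> w i j = 0) =
    (fun w : env R => w i j) @^-1` [set 0].
  by apply/seteqP; split => w /=; [exact|move=> ->].
by rewrite -[X in measurable X]setTI; apply: measurable_env_at.
Qed.

Lemma visit_mean_kst w U x : ranged M w ->
  visit_mean w U x = (\sum_(j <oo) (kst M w U j (delta x) 0)%:E)%E.
Proof. by move=> wM; apply: eq_eseriesr => j _; rewrite (@quenched_kst R M). Qed.

Definition site (N1 : nat) (i : nat) : int := i%:Z - N1%:Z.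

Lemma itv_site N1 N2 (i : 'I_(N1 + N2).+1) : itv N1 N2 (site N1 i).
Proof. by rewrite /itv /site; have := ltn_ord i; lia. Qed.

Lemma kst_itv w N1 N2 j (phi : int -> R) x :
  kst M w (itv N1 N2) j phi x =
  \sum_(i < (N1 + N2).+1) phi (site N1 i) * kst M w (itv N1 N2) j (delta (site N1 i)) x.
Proof.
rewrite -kst_sum; apply: eq_kst => y Uy.
have yN : (absz (y + N1%:Z)%R < (N1 + N2).+1)%N by move: Uy; rewrite /itv; lia.
have [i0 i0y] : exists i0 : 'I_(N1 + N2).+1, site N1 i0 = y.
  by exists (Ordinal yN); move: Uy; rewrite /itv /site /=; lia.
rewrite (bigD1 i0)//= i0y /delta eqxx mulr1 big1 ?addr0// => i iy.
case: eqP => [e|_]; last by rewrite mulr0.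
case/eqP: iy; apply/val_inj; move: i0y; rewrite e /site /=; clear; lia.
Qed.

Lemma series_fine_cvg (f : nat -> R) : (forall n, 0 <= f n) ->
  (\sum_(n <oo) (f n)%:E < +oo)%E ->
  \sum_(j < n) f j @[n --> \oo] --> fine (\sum_(n <oo) (f n)%:E)%E.
Proof.
move=> f0 fo; set S := (\sum_(n <oo) _)%E.
have Sf : S \is a fin_num by rewrite ge0_fin_numE//; apply: nneseries_ge0 => n _ _; rewrite lee_fin.
have : (\sum_(0 <= j < n) (f j)%:E)%E @[n --> \oo] --> (fine S)%:E.
  by rewrite fineK//; apply: is_cvg_nneseries => n _ _; rewrite lee_fin.
move=> /fine_cvg; apply: cvg_trans; apply: near_eq_cvg; apply: nearW => n /=.
by rewrite sumEFin/= big_mkord.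
Qed.

(** The supermartingale inequality for the walk started at 0, where the Lyapunov function equals 1,
    rearranged by the site visited. It is linear in the mean visits with deterministic weights. *)
Lemma visit_lyapunov w N1 N2 (lam : R) : ranged M w -> 0 < lam -> lam * M%:R <= 1 / 2 ->
  (forall x, itv N1 N2 x -> visit_mean w (itv N1 N2) x < +oo)%E ->
  \sum_(i < (N1 + N2).+1) expR (- (lam * (site N1 i)%:~R)) *
     (lam * fdrift M w (site N1 i) - 2 * (lam * M%:R) ^+ 2) *
     fine (visit_mean w (itv N1 N2) (site N1 i)) <= 1.
Proof.
move=> wM l0 lM vfin; set U := itv N1 N2.
pose phi (y : int) : R := expR (- (lam * y%:~R)).
have H : (fun n => \sum_(i < (N1 + N2).+1) (phi (site N1 i) - Qop M w phi (site N1 i)) *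
     \sum_(j < n) kst M w U j (delta (site N1 i)) 0) @ \oo -->
   \sum_(i < (N1 + N2).+1) (phi (site N1 i) - Qop M w phi (site N1 i)) *
     fine (visit_mean w U (site N1 i)).
  apply: cvg_big => [|i _]; first exact: add_continuous.
  apply: cvgMl_tmp; rewrite visit_mean_kst//; apply: series_fine_cvg.
    by move=> n; apply: kst_ge0 => y _; exact: delta_ge0.
  by rewrite -visit_mean_kst// vfin// itv_site.
apply: (@le_trans _ _ (\sum_(i < (N1 + N2).+1) (phi (site N1 i) - Qop M w phi (site N1 i)) *
     fine (visit_mean w U (site N1 i)))).
  apply: ler_sum => i _; rewrite ler_wpM2r ?fine_ge0 ?visit_mean_ge0//.
  exact: exp_lyapunov.
rewrite -(cvg_lim _ H)//; apply: limr_le; first by apply/cvg_ex; eexists; exact: H.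
apply: nearW => n.
have -> : 1 = phi 0 by rewrite /phi mulr0z mulr0 oppr0 expR0.
rewrite (le_trans _ (@kst_supermartingale R M w U n phi 0 (fun y => expR_ge0 _)))//.
under eq_bigr do rewrite mulr_sumr.
rewrite exchange_big/=; apply: ler_sum => j _.
by rewrite [leRHS]kst_itv.
Qed.

End kalikow_estimate.

(** * Weighted visits integrated over the environment *)

Section integrated_estimate.
Context {R : realType} (M : nat) (M1 : (1 <= M)%N) (P : probability (env R) R)
  (PM : finite_range P M) (PK : kalikow P M).
Implicit Types (w : env R).

Lemma ae_ranged : \forall w \ae P, ranged M w.
Proof. by apply: (ae_prob1 (measurable_ranged M)); exact: PM. Qed.

(** The drift is shifted by its bound so that the integrand becomes nonnegative; [drift] is replaced
    by [fdrift], with which it agrees almost surely. *)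
Lemma integral_drift_visits (e : R) N1 N2 x : itv N1 N2 x ->
  (\int[P]_w visit_mean w (itv N1 N2) x < +oo)%E ->
  (e%:E * \int[P]_w visit_mean w (itv N1 N2) x <=
   \int[P]_w ((drift (env_shift x w))%:E * visit_mean w (itv N1 N2) x))%E ->
  (((e + fdrift_bd M) * fine (\int[P]_w visit_mean w (itv N1 N2) x))%:E <=
   \int[P]_w ((fdrift M w x + fdrift_bd M)%:E * visit_mean w (itv N1 N2) x))%E.
Proof.
move=> Ux dfin He; set U := itv N1 N2 in Ux dfin He *.
have mV := @measurable_visit_mean R U x.
have V0 w : (0 <= visit_mean w U x)%E by exact: visit_mean_ge0.
have d0 : (0 <= \int[P]_w visit_mean w U x)%E by exact: integral_ge0.
have dfin' : (\int[P]_w visit_mean w U x)%E \is a fin_num by rewrite ge0_fin_numE.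
have iV : P.-integrable setT (fun w => visit_mean w U x).
  apply/integrableP; split => //.
  by under eq_integral do rewrite gee0_abs//.
have mDV : measurable_fun setT (fun w => (fdrift M w x)%:E * visit_mean w U x)%E.
  by apply: emeasurable_funM => //; apply/measurable_EFinP; exact: measurable_fdrift.
have iBV : P.-integrable setT (fun w => (fdrift_bd M)%:E * visit_mean w U x)%E.
  exact: integrableZl.
have iDV : P.-integrable setT (fun w => (fdrift M w x)%:E * visit_mean w U x)%E.
  apply: le_integrable iBV => // w _.
  rewrite !abseM lee_wpmul2r ?abse_ge0//= lee_fin.
  by rewrite (le_trans (fdrift_le _ _ _))// ler_norm.
rewrite [leRHS](ae_eq_integral (fun w => (fdrift M w x)%:E * visit_mean w U x +
    (fdrift_bd M)%:E * visit_mean w U x)%E) //; last 3 first.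
- apply: emeasurable_funM => //; apply/measurable_EFinP.
  by apply: measurable_funD => //; exact: measurable_fdrift.
- by apply: emeasurable_funD => //; exact: emeasurable_funM.
- have := integrable_ae measurableT iV; apply: filterS => w /(_ Logic.I) Vw _.
  by rewrite EFinD muleDl// fin_num_adde_defl// fin_numM.
rewrite integralD// [X in (_ <= _ + X)%E]integralZl// mulrDl EFinD !EFinM fineK// leeD2r//.
rewrite (le_trans He)// le_eqVlt; apply/orP; left; apply/eqP.
apply: ae_eq_integral => //.
  apply: emeasurable_funM => //; apply/measurable_EFinP.
  exact: (measurableT_comp (@measurable_drift R) (@measurable_env_shift R x)).
have := ae_ranged; apply: filterS => w wM _.
by rewrite (@drift_shiftE R M).
Qed.

Lemma kalikow_estimate : exists lam C : R, 0 < lam /\ forall N1 N2,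
  (forall x, itv N1 N2 x -> (\int[P]_w visit_mean w (itv N1 N2) x < +oo)%E) /\
  \sum_(i < (N1 + N2).+1) expR (- (lam * (site N1 i)%:~R)) *
    fine (\int[P]_w visit_mean w (itv N1 N2) (site N1 i)) <= C.
Proof.
have [e e0 He] := kalikow_itv M1 PK.
have M0 : 0 < M%:R :> R by rewrite ltr0n.
(* The first bound makes the expansion of the exponential valid; the second keeps the quadratic
   error [2 * (lam * M%:R) ^+ 2] below half of the gain [lam * e]. *)
pose lam := Num.min (1 / (2 * M%:R)) (e / (4 * M%:R ^+ 2)).
have l0 : 0 < lam by rewrite lt_min !divr_gt0// ?mulr_gt0// exprn_gt0.
have lM : lam * M%:R <= 1 / 2.
  have : lam <= 1 / (2 * M%:R) by rewrite ge_min lexx.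
  by rewrite ler_pdivlMr ?mulr_gt0//; lra.
have l2 : 2 * (lam * M%:R) ^+ 2 <= lam * e / 2.
  have : lam <= e / (4 * M%:R ^+ 2) by rewrite ge_min lexx orbT.
  rewrite ler_pdivlMr ?mulr_gt0 ?exprn_gt0// => H.
  have := ler_wpM2l (ltW l0) H; rewrite exprMn; lra.
(* The half of the gain that is left, [lam * e / 2], times the weighted sum is at most 1. *)
exists lam, (2 / (lam * e)); split => // N1 N2; split.
  by move=> x /He[].
set U := itv N1 N2.
pose phi i : R := expR (- (lam * (site N1 i)%:~R)).
pose V i w := visit_mean w U (site N1 i).
pose t i := fine (\int[P]_w V i w).
pose b : R := 2 * (lam * M%:R) ^+ 2.
pose B : R := fdrift_bd M.
have B0 : 0 <= B by exact: ler0n.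
have b0 : 0 <= b by rewrite /b mulr_ge0// exprn_ge0// mulr_ge0// ltW.
have phi0 i : 0 <= phi i by exact: expR_ge0.
have V0 i w : (0 <= V i w)%E by exact: visit_mean_ge0.
have mV i : measurable_fun setT (V i) by exact: measurable_visit_mean.
have Vfin (i : 'I_(N1 + N2).+1) : (\int[P]_w V i w)%E = (t i)%:E.
  rewrite fineK// ge0_fin_numE ?integral_ge0//.
  by have [] := He N1 N2 (site N1 i) (itv_site i).
have t0 i : 0 <= t i by rewrite fine_ge0// integral_ge0.
have DB0 w i : 0 <= fdrift M w (site N1 i) + B.
  by have := fdrift_le M w (site N1 i); rewrite ler_norml /B => /andP[]; lra.
have mDB i : measurable_fun setT
    (fun w => (fdrift M w (site N1 i) + B)%:E * V i w)%E.
  apply: emeasurable_funM => //; apply/measurable_EFinP.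
  by apply: measurable_funD => //; exact: measurable_fdrift.
(* The quenched inequality with [B] added to the drift and the negative terms moved to the right:
   both sides become sums of nonnegative functions and can be integrated term by term. *)
pose L w := (\sum_(i < (N1 + N2).+1)
  (phi i * lam)%:E * ((fdrift M w (site N1 i) + B)%:E * V i w))%E.
pose RR w := (1 + \sum_(i < (N1 + N2).+1) (phi i * (b + lam * B))%:E * V i w)%E.
have aeV : \forall w \ae P, forall i : 'I_(N1 + N2).+1, V i w \is a fin_num.
  apply: filter_forall => i.
  have iV : P.-integrable setT (V i).
    apply/integrableP; split => //.
    under eq_integral do rewrite gee0_abs//.
    by rewrite Vfin ltry.
  by have := integrable_ae measurableT iV; apply: filterS => w; exact.
have LR : \forall w \ae P, (L w <= RR w)%E.
  have := ae_ranged; apply: filterS2 aeV => w Vw wM.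
  have := @visit_lyapunov R M w N1 N2 lam wM l0 lM.
  have Vw' x : itv N1 N2 x -> (visit_mean w U x < +oo)%E.
    move=> Ux.
    have [i <-] : exists i : 'I_(N1 + N2).+1, site N1 i = x.
      have yN : (absz (x + N1%:Z)%R < (N1 + N2).+1)%N by move: Ux; rewrite /itv; lia.
      by exists (Ordinal yN); move: Ux; rewrite /itv /site /=; lia.
    by have := Vw i; rewrite /V fin_numElt => /andP[].
  move=> /(_ Vw') H.
  rewrite /L /RR.
  under eq_bigr => i _ do rewrite -[V i w]fineK// -!EFinM.
  under [X in (_ <= _ + X)%E]eq_bigr => i _ do rewrite -[V i w]fineK// -!EFinM.
  rewrite !sumEFin -EFinD lee_fin -lerBlDr -sumrB (le_trans _ H)//.
  apply: ler_sum => i _; rewrite -/(phi i) -/b -/(V i w) le_eqVlt; apply/orP; left.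
  by apply/eqP; ring.
have L0 i w : (0 <= (phi i * lam)%:E * ((fdrift M w (site N1 i) + B)%:E * V i w))%E.
  by rewrite mule_ge0 ?mule_ge0// lee_fin ?DB0// mulr_ge0// ltW.
have RR0 i w : (0 <= (phi i * (b + lam * B))%:E * V i w)%E.
  by rewrite mule_ge0// lee_fin mulr_ge0// addr_ge0// mulr_ge0// ltW.
have mL (i : 'I_(N1 + N2).+1) : measurable_fun setT
    (fun w => (phi i * lam)%:E * ((fdrift M w (site N1 i) + B)%:E * V i w))%E.
  exact: emeasurable_funM.
have mRR (i : 'I_(N1 + N2).+1) : measurable_fun setT
    (fun w => (phi i * (b + lam * B))%:E * V i w)%E.
  exact: emeasurable_funM.
have IL : (\sum_(i < (N1 + N2).+1) ((phi i * lam) * ((e + B) * t i))%:E <= \int[P]_w L w)%E.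
  rewrite ge0_integral_sum//; apply: lee_sum => i _.
  rewrite ge0_integralZl_EFin//; last 2 first.
  - by move=> w _; rewrite mule_ge0// lee_fin.
  - by rewrite mulr_ge0// ltW.
  rewrite EFinM; apply: lee_wpmul2l; first by rewrite lee_fin mulr_ge0 ?(ltW l0).
  have [h1 h2] := He N1 N2 (site N1 i) (itv_site i).
  exact: integral_drift_visits (itv_site i) h1 h2.
have IR : (\int[P]_w RR w = 1 + \sum_(i < (N1 + N2).+1) (phi i * (b + lam * B) * t i)%:E)%E.
  rewrite ge0_integralD//; last 2 first.
  - by move=> w _; apply: sume_ge0.
  - exact: emeasurable_sum.
  rewrite integral_cst// [X in (1 * X)%E]probability_setT mul1e; congr (_ + _)%E.
  rewrite ge0_integral_sum//; apply: eq_bigr => i _.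
  rewrite ge0_integralZl_EFin//; last by rewrite mulr_ge0// addr_ge0// mulr_ge0// ltW.
  by rewrite Vfin.
have LRint : (\int[P]_w L w <= \int[P]_w RR w)%E.
  apply: ae_ge0_le_integral => //.
  - by move=> w _; apply: sume_ge0.
  - exact: emeasurable_sum.
  - by move=> w _; rewrite adde_ge0//; apply: sume_ge0.
  - by apply: emeasurable_funD => //; exact: emeasurable_sum.
  - by move: LR; apply: filterS => w + _.
move: LRint; rewrite IR => /(le_trans IL).
rewrite !sumEFin -EFinD lee_fin -lerBlDr -sumrB => H.
rewrite ler_pdivlMr ?mulr_gt0//.
apply: (@le_trans _ _ (2 * \sum_(i < (N1 + N2).+1)
   (phi i * lam * ((e + B) * t i) - phi i * (b + lam * B) * t i))); last by lra.
rewrite mulr_suml mulr_sumr; apply: ler_sum => i _.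
rewrite -/(phi i) -/(V i) -/(t i).
have pt : 0 <= phi i * t i by rewrite mulr_ge0.
have := ler_wpM2l pt l2; rewrite -/b; nra.
Qed.

End integrated_estimate.

(** * Environments with transience and a finite Green function *)

Section good_environments.
Context {R : realType} (M : nat).
Implicit Types (w : env R).

Lemma env_ext w1 w2 : (forall i j, w1 i j = w2 i j) -> w1 = w2.
Proof.
case: w1 w2 => [f f1 f2] [g g1 g2] /= fg.
have e : f = g by apply/funext => i; apply/funext => j.
rewrite -e in g1 g2 *.
by rewrite (Prop_irrelevance f1 g1) (Prop_irrelevance f2 g2).
Qed.

Lemma env_shiftD (a b : int) w : env_shift a (env_shift b w) = env_shift (b + a) w.
Proof. by apply: env_ext => i j; rewrite /= !addrA. Qed.

Lemma env_shift_0 w : env_shift 0 w = w.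
Proof. by apply: env_ext => i j; rewrite /= !add0r. Qed.

Lemma kst_sub w (U V : pred int) j x : (forall y, U y -> V y) ->
  kst M w U j (fun=> 1) x <= kst M w V j (fun=> 1) x.
Proof.
move=> UV; elim: j x => [|j IH] x /=; (case: ifPn => [/UV ->//|_]).
- by case: ifP.
- exact: Qop_le.
- by case: ifP => // _; apply: Qop_ge0 => y; exact: kst_ge0.
Qed.

(** Every clause ranges over all sites, which makes the property invariant under shifts. *)
Definition good (kappa : R) w := [/\ ranged M w,
  (forall i j : int, `|i - j| <= M%:Z -> kappa < w i j),
  (forall (K x : int) (e : R), 0 < e -> exists j, kst M w (upto K) j (fun=> 1) x < e) &
  (forall z, exists C, forall n, greenn M w n z z <= C)].

Lemma good_shift kappa w z : good kappa w -> good kappa (env_shift z w).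
Proof.
move=> [wM well wtrans gfin]; split.
- exact: ranged_shift.
- by move=> i j ij; apply: well; move: ij; clear; lia.
- move=> K x e e0; have [j je] := wtrans (z + K) (z + x) e e0; exists j.
  rewrite kst_shift (le_lt_trans _ je)//; apply: kst_sub => y.
  by rewrite /upto; clear; lia.
- move=> y; have [C gC] := gfin (z + y); exists C => n.
  by rewrite greenn_shift.
Qed.

End good_environments.

Section ae_good.
Context {R : realType} (P : probability (env R) R).
Implicit Types (w : env R).

Lemma ae_forall_int (Q : int -> env R -> Prop) :
  (forall i, \forall w \ae P, Q i w) -> \forall w \ae P, forall i, Q i w.
Proof.
move=> H.
have H1 := ae_foralln (fun n => H (Posz n)).
have H2 := ae_foralln (fun n => H (Negz n)).
by apply: filterS2 H1 H2 => w h1 h2 [n|n].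
Qed.

Lemma ae_shift (Pinv : shift_invariant P) z (Q : env R -> Prop) :
  (\forall w \ae P, Q w) -> \forall w \ae P, Q (env_shift z w).
Proof.
move=> [N [mN N0 QN]]; exists (env_shift z @^-1` N); split.
- by rewrite -[X in measurable X]setTI; exact: measurable_env_shift.
- by rewrite Pinv.
- by move=> w /= nQ; exact: QN.
Qed.

Lemma integral_series_le (a : nat -> env R -> R) (C : R) :
  (forall j w, 0 <= a j w) -> (forall j, measurable_fun setT (a j)) ->
  (forall n, \int[P]_w (\sum_(j < n) a j w)%:E <= C%:E)%E ->
  (\int[P]_w (\sum_(j <oo) (a j w)%:E) <= C%:E)%E.
Proof.
move=> a0 ma aC.
have ma' j : measurable_fun setT (fun w => (a j w)%:E) by exact/measurable_EFinP.
rewrite integral_nneseries//; last by move=> n w _; rewrite lee_fin.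
apply: lime_le.
  by apply: is_cvg_nneseries => n _ _; apply: integral_ge0 => w _; rewrite lee_fin.
apply: nearW => n; rewrite -ge0_integral_sum//; last by move=> j w _; rewrite lee_fin.
apply: le_trans (aC n); apply: ge0_le_integral => //.
- by move=> w _; apply: sume_ge0 => j _; rewrite lee_fin.
- exact: emeasurable_sum.
- by apply/measurable_EFinP; apply: measurable_sum.
- by move=> w _; rewrite sumEFin big_mkord.
Qed.

Lemma ae_series_fin (a : nat -> env R -> R) (C : R) :
  (forall j w, 0 <= a j w) -> (forall j, measurable_fun setT (a j)) ->
  (forall n, \int[P]_w (\sum_(j < n) a j w)%:E <= C%:E)%E ->
  \forall w \ae P, (\sum_(j <oo) (a j w)%:E < +oo)%E.
Proof.
move=> a0 ma aC; have := integral_series_le a0 ma aC => H.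
have s0 w : (0 <= \sum_(j <oo) (a j w)%:E)%E.
  by apply: nneseries_ge0 => j _ _; rewrite lee_fin.
have iS : P.-integrable setT (fun w => \sum_(j <oo) (a j w)%:E)%E.
  apply/integrableP; split.
    apply: ge0_emeasurable_sum => [j w _ _|j _]; first by rewrite lee_fin.
    exact/measurable_EFinP.
  by under eq_integral do rewrite gee0_abs//; rewrite (le_lt_trans H)// ltry.
have := integrable_ae measurableT iS; apply: filterS => w /(_ Logic.I).
by rewrite fin_numElt => /andP[].
Qed.

Context (M : nat) (M1 : (1 <= M)%N) (Pinv : shift_invariant P)
  (PM : finite_range P M) (PK : kalikow P M).

Lemma visits_le_mean w N1 N2 n x : ranged M w ->
  ((\sum_(j < n) kst M w (itv N1 N2) j (delta x) 0)%:E <= visit_mean w (itv N1 N2) x)%E.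
Proof.
move=> wM; rewrite (visit_mean_kst _ _ wM) -sumEFin -(big_mkord xpredT
  (fun j => (kst M w (itv N1 N2) j (delta x) 0)%:E)).
apply: nneseries_lim_ge => j _ _; rewrite lee_fin; apply: kst_ge0 => y _.
exact: delta_ge0.
Qed.

(** During [n] steps the half-line is indistinguishable from [- n M, K]. There the weight
    [exp(- lam x)] is at least [exp(- lam K)], so the uniform estimate bounds the unweighted number
    of visits. *)
Lemma upto_series_bound (K : nat) : exists C : R, forall n,
  (\int[P]_w (\sum_(j < n) kst M w (upto K.+1) j (fun=> 1) 0)%:E <= C%:E)%E.
Proof.
have [lam [C [l0 H]]] := kalikow_estimate M1 PM PK.
exists (expR (lam * K%:R) * C) => n.
have [dfin HC] := H (n * M)%N K.
set N1 := (n * M)%N in dfin HC; set U := itv N1 K in dfin HC.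
have V0 w i : (0 <= visit_mean w U (site N1 i))%E by exact: visit_mean_ge0.
apply: (@le_trans _ _ (\int[P]_w (\sum_(i < (N1 + K).+1) visit_mean w U (site N1 i)))%E).
  apply: ae_ge0_le_integral => //.
  - by move=> w _; rewrite lee_fin; apply: sumr_ge0 => j _; exact: kst_ge0.
  - by apply/measurable_EFinP; apply: measurable_sum => j; exact: measurable_kst.
  - by move=> w _; apply: sume_ge0.
  - by apply: emeasurable_sum => i; exact: measurable_visit_mean.
  have := ae_ranged PM; apply: filterS => w wM _.
  apply: (@le_trans _ _ (\sum_(i < (N1 + K).+1)
      \sum_(j < n) kst M w U j (delta (site N1 i)) 0)%:E).
    rewrite lee_fin exchange_big/=; apply: ler_sum => j _.
    rewrite (@kst_local R M w (upto K.+1) U) => [|y yj].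
      by rewrite kst_itv; apply: ler_sum => i _; rewrite mul1r.
    have jn : (j * M <= n * M)%N by rewrite leq_mul2r ltnW ?orbT.
    by move: yj jn; rewrite /upto /U /itv /N1; clear; lia.
  by rewrite -sumEFin; apply: lee_sum => i _; exact: visits_le_mean.
rewrite ge0_integral_sum//; last by move=> i; exact: measurable_visit_mean.
have tE (i : 'I_(N1 + K).+1) : (\int[P]_w visit_mean w U (site N1 i) =
    (fine (\int[P]_w visit_mean w U (site N1 i)))%:E)%E.
  by rewrite fineK// ge0_fin_numE ?integral_ge0// dfin//; exact: itv_site.
under eq_bigr do rewrite tE.
rewrite sumEFin lee_fin; apply: le_trans (ler_wpM2l (expR_ge0 _) HC).
rewrite mulr_sumr; apply: ler_sum => i _; rewrite mulrA -expRD ler_peMl//.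
  by rewrite fine_ge0// integral_ge0.
rewrite -[leLHS]expR0 ler_expR -mulrBr mulr_ge0 ?(ltW l0)// subr_ge0.
rewrite -[K%:R]/(K%:Z%:~R) ler_int.
by have := itv_site i; rewrite /itv => /andP[].
Qed.

(** During [n] steps the line is indistinguishable from [- n M, n M]; of the uniform estimate only
    the term of site 0, with weight 1, is kept. *)
Lemma green_bound : exists C : R, forall n,
  (\int[P]_w (greenn M w n 0 0)%:E <= C%:E)%E.
Proof.
have [lam [C [l0 H]]] := kalikow_estimate M1 PM PK.
exists C => n.
have [dfin HC] := H (n * M)%N (n * M)%N.
set N := (n * M)%N in dfin HC; set U := itv N N in dfin HC.
have V0 w x : (0 <= visit_mean w U x)%E by exact: visit_mean_ge0.
have U0 : U 0 by rewrite /U /itv; clear; lia.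
apply: (@le_trans _ _ (\int[P]_w visit_mean w U 0)%E).
  apply: ae_ge0_le_integral => //.
  - by move=> w _; rewrite lee_fin greenn_ge0.
  - by apply/measurable_EFinP; exact: measurable_greenn.
  - exact: measurable_visit_mean.
  have := ae_ranged PM; apply: filterS => w wM _.
  apply: le_trans (visits_le_mean N N n 0 wM).
  rewrite lee_fin; apply: ler_sum => j _; rewrite (@kst_local R M w predT U)// => y yj.
  have jn : (j * M <= n * M)%N by rewrite leq_mul2r ltnW ?orbT.
  by move: yj jn; rewrite -[predT y]/true /U /itv /N; clear; lia.
rewrite -[X in (X <= _)%E]fineK; last by rewrite ge0_fin_numE ?integral_ge0// dfin.
rewrite lee_fin; apply: le_trans HC.
have i0 : (N < (N + N).+1)%N by rewrite ltnS leq_addr.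
rewrite (bigD1 (Ordinal i0))//= /site subrr mulr0z mulr0 oppr0 expR0 mul1r lerDl.
by apply: sumr_ge0 => i _; rewrite mulr_ge0 ?expR_ge0// fine_ge0// integral_ge0.
Qed.

Lemma measurable_elliptic (kappa : R) :
  measurable [set w : env R | forall i j : int, `|i - j| <= M%:Z -> w i j > kappa].
Proof.
apply: measurable_forall_int => i; apply: measurable_forall_int => j.
have [ij|ij] := pselect (`|i - j| <= M%:Z); last first.
  have -> : (fun w : env R => `|i - j| <= M%:Z -> w i j > kappa) = setT by apply/seteqP; split.
  exact: measurableT.
have -> : (fun w : env R => `|i - j| <= M%:Z -> w i j > kappa) =
    (fun w : env R => w i j) @^-1` `]kappa, +oo[.
  by apply/seteqP; split => w /=; rewrite in_itv/= andbT; [apply|].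
by rewrite -[X in measurable X]setTI; apply: measurable_env_at.
Qed.

Lemma ae_good : exists2 kappa : R, 0 < kappa & \forall w \ae P, good M kappa w.
Proof.
have [[kappa [/andP[k0 _] Pk]] _] := PK.
exists kappa => //.
have H1 := ae_ranged PM.
have H2 : \forall w \ae P, forall i j : int, `|i - j| <= M%:Z -> (w : env R) i j > kappa.
  by apply: (ae_prob1 (measurable_elliptic kappa)).
have H3 : \forall w \ae P, forall (x : int) (K : nat) (e : R), 0 < e ->
    exists j, kst M (env_shift x w) (upto K.+1) j (fun=> 1) 0 < e.
  apply: ae_forall_int => x; apply: (@ae_shift Pinv x (fun w => forall (K : nat)
    (e : R), 0 < e -> exists j, kst M w (upto K.+1) j (fun=> 1) 0 < e)).
  apply: ae_foralln => K.
  have [C HC] := upto_series_bound K.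
  have s0 j w : 0 <= kst M w (upto K.+1) j (fun=> 1) 0 :> R by exact: kst_ge0.
  have := ae_series_fin s0 (fun j => measurable_kst _ _ _ _ _) HC.
  apply: filterS => w Sfin e e0; apply: contrapT => /forallNP H.
  (* Otherwise all terms would be at least [e], and the partial sums would exceed the finite
     total. *)
  have ge j : e <= kst M w (upto K.+1) j (fun=> 1) 0 by rewrite leNgt; apply/negP.
  have S0 : (0 <= \sum_(j <oo) (kst M w (upto K.+1) j (fun=> 1) 0)%:E)%E.
    by apply: nneseries_ge0 => j _ _; rewrite lee_fin.
  set S := (\sum_(j <oo) _)%E in Sfin S0.
  have le n : n%:R * e <= fine S.
    rewrite -lee_fin fineK ?ge0_fin_numE//.
    apply: le_trans (nneseries_lim_ge n _); last by move=> j _ _; rewrite lee_fin.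
    rewrite sumEFin lee_fin mulr_natl -[n in leLHS]subn0 -sumr_const_nat.
    exact: ler_sum.
  have := le (Num.truncn (fine S / e)).+1.
  rewrite leNgt => /negP; apply.
  by rewrite -ltr_pdivrMr// truncnS_gt.
have H4 : \forall w \ae P, forall (x : int), exists C, forall n,
    greenn M (env_shift x w) n 0 0 <= C.
  apply: ae_forall_int => x; apply: (@ae_shift Pinv x (fun w => exists C, forall n,
    greenn M w n 0 0 <= C)).
  have [C HC] := green_bound.
  have s0 j w : 0 <= kst M w predT j (delta 0) 0 :> R.
    by apply: kst_ge0 => y _; exact: delta_ge0.
  have := ae_series_fin s0 (fun j => measurable_kst _ _ _ _ _) HC.
  apply: filterS => w; set S := (\sum_(j <oo) _)%E => Sfin.
  have S0 : (0 <= S)%E by apply: nneseries_ge0 => j _ _; rewrite lee_fin.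
  exists (fine S) => n; rewrite -lee_fin fineK ?ge0_fin_numE//.
  rewrite -sumEFin -(big_mkord xpredT (fun j => (kst M w predT j (delta 0) 0)%:E)).
  by apply: nneseries_lim_ge => j _ _; rewrite lee_fin.
apply: filter_app H1; apply: filter_app H2; apply: filterS2 H3 H4 => w h3 h4 h2 h1.
split => //.
  (* Seen from [x], the half-line below [K] is contained in the one up to [|K - x|]. *)
  move=> K x e e0; have [j je] := h3 x (absz (K - x)) e e0; exists j.
  move: je; rewrite kst_shift addr0; apply: le_lt_trans; apply: kst_sub => y.
  by rewrite /upto; clear; lia.
move=> z; have [C HC] := h4 z; exists C => n.
by have := HC n; rewrite greenn_shift addr0.
Qed.

End ae_good.

(** * The invariant measure *)

Section invariant_density.
Context {R : realType} (M : nat).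
Implicit Types (w : env R).

Lemma green_shift w (z y x : int) :
  green M (env_shift z w) y x = green M w (z + y) (z + x).
Proof. by congr (limn _); apply/funext => n; rewrite greenn_shift. Qed.

(** Shifting the environment shifts the starting points as well, but the limit is the same along
    [z - n] and [- n]. This turns an equation in the site [z] into one for a function of the
    environment. *)
Lemma green_leftE kappa w z : (1 <= M)%N -> 0 < kappa -> good M kappa w ->
  green_left M (env_shift z w) 0 = green_left M w z.
Proof.
move=> M1 k0 gw; have [wM well wtrans gfin] := gw.
have H := @cvg_green_left R M M1 kappa w k0 wM well wtrans gfin z z.
rewrite -(cvg_lim (@Rhausdorff _) H) /green_left; congr (limn _).
by apply/funext => n; rewrite green_shift addr0.
Qed.

(** A version of [green_left] at 0 that is measurable without restriction: the extended series and
    the upper limit exist for every environment. *)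
Definition green_esup w : \bar R := limn_esup (fun n : nat =>
  \sum_(j <oo) (kst M w predT j (delta 0) (- n%:Z))%:E)%E.

Lemma measurable_green_esup : measurable_fun [set: env R] green_esup.
Proof.
apply: measurable_fun_limn_esup => n; apply: ge0_emeasurable_sum => [j w _ _|j _].
  by rewrite lee_fin; apply: kst_ge0 => y _; exact: delta_ge0.
by apply/measurable_EFinP; exact: measurable_kst.
Qed.

Lemma green_series kappa w y z : good M kappa w ->
  (\sum_(j <oo) (kst M w predT j (delta z) y)%:E)%E = (green M w y z)%:E.
Proof.
move=> [wM _ _ gfin]; apply/cvg_lim => //.
rewrite (_ : (fun n => _) = EFin \o (fun n => greenn M w n y z)); last first.
  by apply/funext => n; rewrite sumEFin big_mkord.
by apply: cvg_EFin; [exact: nearW|exact: cvg_greenn].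
Qed.

Lemma green_esupE kappa w : (1 <= M)%N -> 0 < kappa -> good M kappa w ->
  green_esup w = (green_left M w 0)%:E.
Proof.
move=> M1 k0 gw; have [wM well wtrans gfin] := gw.
have H : (\sum_(j <oo) (kst M w predT j (delta 0) (- n%:Z))%:E)%E @[n --> \oo] -->
    (green_left M w 0)%:E.
  apply: cvg_EFin; first by apply: nearW => n; rewrite (green_series _ _ gw).
  have H := @cvg_green_left R M M1 kappa w k0 wM well wtrans gfin 0 0.
  apply: cvg_trans H; apply: near_eq_cvg; apply: nearW => n.
  by rewrite sub0r /= (green_series _ _ gw).
by rewrite /green_esup is_cvg_limn_esupE ?(cvg_lim _ H)//; apply/cvg_ex; eexists; exact: H.
Qed.

Lemma invariant_density (P : probability (env R) R) : (1 <= M)%N ->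
  shift_invariant P -> finite_range P M -> kalikow P M ->
  exists f : env R -> R, [/\ measurable_fun setT f, (forall w, 0 <= f w),
    (\int[P]_w (f w)%:E = 1)%E, (\forall w \ae P, 0 < f w) &
    \forall w \ae P, f w = \sum_(k < M.*2.+1) f (env_shift (nb M 0 k) w) * (w : env R) (nb M 0 k) 0].
Proof.
move=> M1 Pinv PM PK.
have [kappa k0 aegood] := ae_good M1 Pinv PM PK.
(* The truncation makes [g] nonnegative everywhere; on good environments neither it nor [fine]
   changes the value. *)
pose g w := Num.max 0 (fine (green_esup w)).
have g0 w : 0 <= g w by rewrite le_max lexx.
have gE w : good M kappa w -> g w = green_left M w 0.
  move=> gw; rewrite /g (green_esupE M1 k0 gw)/=; apply/max_idPr.
  have [wM well wtrans gfin] := gw.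
  have /andP[+ _] := green_left_bound M1 k0 wM well wtrans gfin 0.
  by apply: le_trans; exact: ltW.
have mg : measurable_fun setT g.
  apply: measurable_maxr => //.
  exact: (measurableT_comp (@fine_measurable R setT measurableT) measurable_green_esup).
have [C HC] := green_bound M1 PM PK.
have gk : \forall w \ae P, kappa <= g w.
  move: aegood; apply: filterS => w gw; rewrite (gE _ gw).
  have [wM well wtrans gfin] := gw.
  by have /andP[] := green_left_bound M1 k0 wM well wtrans gfin 0.
have gC : (\int[P]_w (g w)%:E <= C%:E)%E.
  apply: (@le_trans _ _ (\int[P]_w \sum_(j <oo) (kst M w predT j (delta 0) 0)%:E)%E).
    apply: ae_ge0_le_integral => //.
    - by move=> w _; rewrite lee_fin.
    - exact/measurable_EFinP.
    - move=> w _; apply: nneseries_ge0 => j _ _; rewrite lee_fin.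
      by apply: kst_ge0 => y _; exact: delta_ge0.
    - apply: ge0_emeasurable_sum => [j w _ _|j _].
        by rewrite lee_fin; apply: kst_ge0 => y _; exact: delta_ge0.
      by apply/measurable_EFinP; exact: measurable_kst.
    - move: aegood; apply: filterS => w gw _; rewrite (gE _ gw) (green_series _ _ gw) lee_fin.
      have [wM well wtrans gfin] := gw.
      by have /andP[] := green_left_bound M1 k0 wM well wtrans gfin 0.
  apply: integral_series_le HC => // [j w|j].
    by apply: kst_ge0 => y _; exact: delta_ge0.
  exact: measurable_kst.
have kg : (kappa%:E <= \int[P]_w (g w)%:E)%E.
  rewrite -[leLHS](_ : \int[P]_w (cst kappa%:E) w = _)%E; last first.
    by rewrite integral_cst// [X in (_ * X)%E]probability_setT mule1.
  apply: ae_ge0_le_integral => //.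
  - by move=> w _; rewrite lee_fin ltW.
  - by move=> w _; rewrite lee_fin.
  - exact/measurable_EFinP.
  - by move: gk; apply: filterS => w + _; rewrite lee_fin.
set Z := (\int[P]_w (g w)%:E)%E in gC kg.
have Zfin : Z \is a fin_num.
  by rewrite ge0_fin_numE ?(le_lt_trans gC) ?ltry// integral_ge0// => w _; rewrite lee_fin.
have Z0 : 0 < fine Z by rewrite -lte_fin fineK// (lt_le_trans _ kg)// lte_fin.
exists (fun w => (fine Z)^-1 * g w); split.
- exact: measurable_funM.
- by move=> w; rewrite mulr_ge0// invr_ge0 ltW.
- under eq_integral do rewrite EFinM.
  rewrite ge0_integralZl_EFin//; last 3 first.
  + by move=> w _; rewrite lee_fin.
  + exact/measurable_EFinP.
  + by rewrite invr_ge0 ltW.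
  by rewrite -/Z -(fineK Zfin) -EFinM mulVf// gt_eqF.
- move: gk; apply: filterS => w kw; rewrite mulr_gt0 ?invr_gt0//.
  exact: lt_le_trans kw.
- move: aegood; apply: filterS => w gw.
  have [wM well wtrans gfin] := gw.
  rewrite (gE _ gw) (green_left_inv M1 k0 wM well wtrans gfin) mulr_sumr.
  apply: eq_bigr => k _; rewrite gE; last exact: good_shift.
  by rewrite (green_leftE _ M1 k0 gw) mulrA.
Qed.

End invariant_density.

(** * Change of measure by a density *)

Section density_measure.
Context d (T : measurableType d) {R : realType} (mu : {measure set T -> \bar R})
  (f : T -> R).
Hypotheses (mf : measurable_fun setT f) (f0 : forall x, 0 <= f x).

(* The hypotheses are arguments so that the measure structure can be inferred. *)
Definition dens of measurable_fun setT f & (forall x, 0 <= f x) :=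
  fun A : set T => (\int[mu]_(x in A) (f x)%:E)%E.

Local Notation nu := (dens mf f0).

Let mf' A : measurable A -> measurable_fun A (EFin \o f).
Proof. by move=> mA; apply: measurable_funTS; exact/measurable_EFinP. Qed.

Let dens0 : nu set0 = 0%E. Proof. by rewrite /dens integral_set0. Qed.

Let dens_ge0 A : (0 <= nu A)%E.
Proof. by apply: integral_ge0 => x _; rewrite lee_fin. Qed.

Let dens_sigma_additive : semi_sigma_additive nu.
Proof.
move=> F mF tF mUF; rewrite [X in _ --> X](_ : _ = \sum_(n <oo) nu (F n))%E.
  by apply: is_cvg_nneseries => n _ _; exact: dens_ge0.
rewrite /dens ge0_integral_bigcup//; first exact: mf'.
by move=> x _; rewrite lee_fin.
Qed.

HB.instance Definition _ := isMeasure.Build _ _ _ nu dens0 dens_ge0 dens_sigma_additive.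

Import HBNNSimple.

(** Simple functions first, then monotone convergence on both sides. *)
Lemma integral_dens (g : T -> \bar R) : measurable_fun setT g -> (forall x, 0 <= g x)%E ->
  (\int[nu]_x g x = \int[mu]_x (g x * (f x)%:E))%E.
Proof.
move=> mg g0; pose g_ := nnsfun_approx measurableT mg.
have fE0 x : (0 <= (f x)%:E)%E by rewrite lee_fin.
have mfE : measurable_fun setT (EFin \o f) by exact: mf'.
transitivity (limn (fun n => \int[nu]_x (g_ n x)%:E)%E).
  rewrite -monotone_convergence//.
  - apply: eq_integral => x _; apply/esym/cvg_lim => //; exact: cvg_nnsfun_approx.
  - by move=> n; exact/measurable_EFinP.
  - by move=> n x _; rewrite lee_fin.
  - by move=> x _ m n mn; rewrite lee_fin; exact/lefP/nd_nnsfun_approx.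
transitivity (limn (fun n => \int[mu]_x ((g_ n x)%:E * (f x)%:E))%E); last first.
  rewrite -monotone_convergence//.
  - apply: eq_integral => x _; apply/cvg_lim => //.
    by apply: cvgeZr => //; exact: cvg_nnsfun_approx.
  - by move=> n; apply: emeasurable_funM => //; exact/measurable_EFinP.
  - by move=> n x _; rewrite mule_ge0// lee_fin.
  - move=> x _ m n mn; rewrite lee_wpmul2r// lee_fin; exact/lefP/nd_nnsfun_approx.
congr (limn _); apply/funext => n; set h := g_ n.
rewrite integralT_nnsfun sintegralE.
have h0 r x : (0 <= (r * \1_(h @^-1` [set r]) x)%:E)%E.
  by rewrite EFinM nnfun_muleindic_ge0.
transitivity (\int[mu]_x (\sum_(r \in range h) ((r * \1_(h @^-1` [set r]) x)%:E * (f x)%:E)))%E; last first.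
  apply: eq_integral => x _; rewrite -ge0_mule_fsuml//.
  by rewrite fsumEFin// -fimfunE.
rewrite ge0_integral_fsum//; last 2 first.
- by move=> r; apply: emeasurable_funM => //; apply/measurable_EFinP; exact: measurable_funM.
- by move=> r x _; rewrite mule_ge0.
apply: eq_fsbigr => r _.
have [r0|r0] := leP 0 r; last first.
  rewrite preimage_nnfun0// measure0 mule0 integral0_eq// => x _.
  by rewrite indic0 mulr0 mul0e.
rewrite -[X in (_ * X)%E]/(\int[mu]_(x in h @^-1` [set r]) (f x)%:E)%E.
rewrite integral_mkcond -ge0_integralZl_EFin//; last 2 first.
- by move=> x _; apply: erestrict_ge0.
- by apply/(measurable_restrictT _ _).1 => //; exact: mf'.
apply: eq_integral => x _; rewrite EFinM -muleA; congr (_ * _)%E.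
by rewrite epatch_indic muleC.
Qed.

End density_measure.

Section stationarity.
Context {R : realType} (M : nat) (P : probability (env R) R)
  (Pinv : shift_invariant P) (PM : finite_range P M) (f : env R -> R).
Hypotheses (mf : measurable_fun setT f) (f0 : forall w, 0 <= f w)
  (f1 : (\int[P]_w (f w)%:E = 1)%E)
  (finv : \forall w \ae P, f w =
    \sum_(k < M.*2.+1) f (env_shift (nb M 0 k) w) * (w : env R) (nb M 0 k) 0).
Implicit Types (w : env R).

Lemma integral_env_shift z (g : env R -> \bar R) : measurable_fun setT g ->
  (forall w, 0 <= g w)%E -> (\int[P]_w g (env_shift z w) = \int[P]_w g w)%E.
Proof.
move=> mg g0.
transitivity (\int[distribution P (env_shift z)]_w g w)%E.
  by rewrite ge0_integral_pushforward.
by apply: eq_measure_integral => A mA _; exact: Pinv.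
Qed.

Let mEf : measurable_fun setT (EFin \o f). Proof. exact/measurable_EFinP. Qed.

Let f0E w : (0 <= (f w)%:E)%E. Proof. by rewrite lee_fin. Qed.

Let mg_shift z (g : env R -> \bar R) : measurable_fun setT g ->
  measurable_fun setT (fun w => g (env_shift z w)).
Proof. by move=> mg; exact: (measurableT_comp mg (@measurable_env_shift R z)). Qed.

(** Each term of the left side is moved by the shift-invariance of [P], so that [g] appears at the
    unshifted environment; the factors left over add up to [f] by [finv]. *)
Lemma stationary (g : env R -> \bar R) : measurable_fun setT g -> (forall w, 0 <= g w)%E ->
  (\int[P]_w ((\sum_(k < M.*2.+1) (w 0 (nb M 0 k))%:E * g (env_shift (nb M 0 k) w)) *
     (f w)%:E) = \int[P]_w (g w * (f w)%:E))%E.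
Proof.
move=> mg g0.
pose h (k : nat) w : \bar R :=
  ((w (- nb M 0 k) 0)%:E * g w * (f (env_shift (- nb M 0 k) w))%:E)%E.
have h0 k w : (0 <= h k w)%E by rewrite !mule_ge0 ?lee_fin ?env_ge0.
have mwij (i j : int) : measurable_fun setT (fun w : env R => (w i j)%:E).
  by apply/measurable_EFinP; exact: measurable_env_at.
have mh k : measurable_fun setT (h k).
  apply: emeasurable_funM; last exact: (mg_shift _ mEf).
  by apply: emeasurable_funM.
transitivity (\int[P]_w \sum_(k < M.*2.+1) h k (env_shift (nb M 0 k) w))%E.
  apply: eq_integral => w _; rewrite ge0_sume_distrl => [|k _].
    apply: eq_bigr => k _; rewrite /h env_shiftD subrr env_shift_0/=.
    by rewrite subrr addr0.
  by rewrite mule_ge0// lee_fin env_ge0.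
rewrite ge0_integral_sum//; last by move=> k; exact: mg_shift.
under eq_bigr do rewrite integral_env_shift//.
rewrite -ge0_integral_sum//.
apply: ae_eq_integral => //.
- exact: emeasurable_sum.
- exact: emeasurable_funM.
move: finv; apply: filterS => w -> _.
rewrite -sumEFin ge0_sume_distrr => [|k _]; last by rewrite lee_fin mulr_ge0// env_ge0.
(* Moving the integral turns each displacement into its opposite, which is index reversal on
   ['I_(2M+1)]. *)
rewrite (reindex_inj rev_ord_inj); apply: eq_bigr => k _.
rewrite /h; have -> : nb M 0 (rev_ord k) = - nb M 0 k.
  by rewrite /nb /=; have := ltn_ord k; lia.
by rewrite opprK EFinM -muleA muleCA; congr (_ * _)%E; rewrite muleC.
Qed.

(** The mass is already 1; [mnormalize] supplies the structure of a probability, and [P] is only its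
    default value. *)
Definition Pinf : probability (env R) R := mnormalize (dens P mf f0) P.

Lemma PinfE A : Pinf A = dens P mf f0 A.
Proof.
have d1 : dens P mf f0 setT = 1%E by rewrite /dens.
by rewrite /Pinf/= /mnormalize/= d1 onee_eq0/= invr1 mule1.
Qed.

Lemma integral_Pinf (g : env R -> \bar R) : measurable_fun setT g ->
  (forall w, 0 <= g w)%E -> (\int[Pinf]_w g w = \int[P]_w (g w * (f w)%:E))%E.
Proof.
move=> mg g0; rewrite -integral_dens//.
by apply: eq_measure_integral => A mA _; exact: PinfE.
Qed.

Lemma Pinf_dominates : Pinf `<< P.
Proof.
apply/null_content_dominatesP => A mA PA; rewrite PinfE /dens.
apply: null_set_integral => //.
by apply: measurable_funTS.
Qed.

Lemma Pinf_invariant : env_process_invariant Pinf.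
Proof.
move=> A mA.
have mterm i : measurable_fun setT (fun w : env R => (w 0 i * \1_A (env_shift i w))%:E).
  apply/measurable_EFinP; apply: measurable_funM; first exact: measurable_env_at.
  exact: (measurableT_comp (measurable_indic mA) (@measurable_env_shift R i)).
have t0 w i : (0 <= (w 0 i * \1_A (env_shift i w))%:E)%E.
  by rewrite lee_fin mulr_ge0// env_ge0.
rewrite integral_Pinf; last 2 first.
- under eq_fun do rewrite esum_int//.
  by apply: emeasurable_funD; apply: ge0_emeasurable_sum.
- by move=> w; apply: esum_ge0.
pose g w : \bar R := (\1_A w)%:E.
have mg : measurable_fun setT g by apply/measurable_EFinP; exact: measurable_indic.
have g0 w : (0 <= g w)%E by rewrite lee_fin.
transitivity (\int[P]_w (g w * (f w)%:E))%E; last first.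
  rewrite PinfE /dens [RHS]integral_mkcond; apply: eq_integral => w _.
  by rewrite epatch_indic muleC.
rewrite -(stationary mg g0); apply: ae_eq_integral => //.
- apply: emeasurable_funM => //; under eq_fun do rewrite esum_int//.
  by apply: emeasurable_funD; apply: ge0_emeasurable_sum.
- apply: emeasurable_funM => //; apply: emeasurable_sum => k.
  apply: emeasurable_funM; last exact: mg_shift.
  by apply/measurable_EFinP; exact: measurable_env_at.
have := ae_ranged PM; apply: filterS => w wM _; congr (_ * _)%E.
rewrite (@esum_nb _ M 0)//; last by move=> i iM; rewrite wM ?mul0r.
Qed.

End stationarity.

(** * Zero-one law and maximal inequality *)

Section zero_one.
Context {R : realType} (M : nat) (M1 : (1 <= M)%N) (kappa : R) (w : env R).
Hypotheses (k0 : 0 < kappa) (gw : good M kappa w).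
Variable B : set walk.
Hypotheses (mB : measurable B) (Bcons : forall x, wcons x @^-1` B = B).

Let wM : ranged M w. Proof. by case: gw. Qed.

Lemma quenched_invariant_const x y : quenched w x B = quenched w y B.
Proof.
have [_ well wtrans _] := gw.
pose h x := fine (quenched w x B).
have hE z : quenched w z B = (h z)%:E by rewrite fineK// fin_num_measure.
have h1 z : `|h z| <= 1.
  rewrite ger0_norm ?fine_ge0// -lee_fin -hE; exact: probability_le1.
rewrite !hE; congr EFin.
apply: (liouville M1 k0 wM well wtrans _ h1) => z.
apply: EFin_inj; rewrite -hE (quenched_step _ wM)// -sumEFin.
by apply: eq_bigr => k _; rewrite Bcons hE.
Qed.

(** [B] has the same probability [c] from every start, hence is independent of each prefix event. If
    [c] is not 0, the law conditioned on [B], called [m] below, has the same finite-dimensional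
    distributions as the quenched law. Uniqueness identifies the two, and [m] gives no mass to the
    complement of [B]. *)
Lemma quenched_zero_one x : quenched w x B = 0%E \/ quenched w x B = 1%E.
Proof.
set c := quenched w x B.
have cE y : quenched w y B = c by exact: quenched_invariant_const.
have c0 : (0 <= c)%E by exact: measure_ge0.
have cfin : c \is a fin_num by rewrite fin_num_measure.
pose indep C := forall y, quenched w y (C `&` B) = (quenched w y C * c)%E.
have indep0 : indep set0 by move=> y; rewrite set0I !measure0 mul0e.
have indepT : indep setT by move=> y; rewrite setTI cE [X in (X * _)%E]probability_setT mul1e.
have indep_step C : measurable C -> (forall y, indep (wcons y @^-1` C)) -> indep C.
  move=> mC H y; rewrite !(quenched_step y wM)//; last exact: measurableI.
  rewrite ge0_sume_distrl => [|k _]; last by rewrite mule_ge0// lee_fin env_ge0.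
  by apply: eq_bigr => k _; rewrite preimage_setI Bcons H muleA.
have indep_cyl n s : indep [set X : walk | forall k, (k <= n)%N -> X k = s k].
  elim: n s => [|n IH] s; (apply: indep_step; first exact: measurable_walk_prefix); move=> y.
    have [sy|sy] := eqVneq (s 0%N) y.
      rewrite (_ : _ @^-1` _ = setT)//; apply/seteqP; split => // X _ k /=.
      by rewrite leqn0 => /eqP ->.
    rewrite (_ : _ @^-1` _ = set0)//; apply/seteqP; split => // X /= /(_ 0%N isT)/= ys.
    by rewrite ys eqxx in sy.
  have [sy|sy] := eqVneq (s 0%N) y.
    rewrite (_ : _ @^-1` _ = [set X : walk | forall k, (k <= n)%N -> X k = s k.+1])//.
    apply/seteqP; split => X /= H.
      by move=> k kn; have := H k.+1 kn.
    by move=> [|k] kn //=; exact: H.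
  rewrite (_ : _ @^-1` _ = set0)//; apply/seteqP; split => // X /= /(_ 0%N isT)/= ys.
  by rewrite ys eqxx in sy.
have [->|c_neq0] := eqVneq c 0%E; [by left|right].
have c_gt0 : 0 < fine c by rewrite fine_gt0// lt0e c_neq0 c0/= ltey_eq cfin.
have ci0 : 0 <= (fine c)^-1 by rewrite invr_ge0 ltW.
pose m : {measure set walk -> \bar R} :=
  mscale (NngNum ci0) (mrestr (quenched w x) mB).
have mE C : m C = ((fine c)^-1%:E * quenched w x (C `&` B))%E by [].
have mc : ((fine c)^-1%:E * c = 1)%E.
  by rewrite -[X in (_ * X)%E](fineK cfin) -EFinM mulVf// gt_eqF.
have m1 : m setT = 1%E.
  by rewrite mE indepT muleCA mc mule1 [LHS]probability_setT.
have mcyl (n : nat) (s : nat -> int) :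
    m [set X : walk | forall k, (k <= n)%N -> X k = s k] =
    ((s 0%N == x)%:R * \prod_(k < n) w (s k) (s k.+1))%:E.
  by rewrite mE indep_cyl muleCA mc mule1 quenched_markov.
have := quenched_uniq m1 mcyl (measurableC mB).
rewrite mE setICl measure0 mule0 probability_setC// -/c => /eqP.
by rewrite sube_eq// ?add0e ?fin_num_adde_defr// => /eqP.
Qed.

End zero_one.

Section escape.
Context {R : realType}.
Implicit Types (X : walk) (s a : R).

Lemma measurable_walk_coord n : measurable_fun [set: walk] (fun X : walk => (X n)%:~R : R).
Proof.
move=> _ B _; rewrite setTI.
rewrite (_ : _ @^-1` _ = \bigcup_(i : int)
  (if `[< B i%:~R >] then [set X : walk | X n = i] else set0)).
  apply: countable_bigcupT_measurable => // i; case: ifP => // _.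
  exact: measurable_walk_at.
apply/seteqP; split => X /=.
  by move=> BX; exists (X n) => //; rewrite ifT//; exact/asboolP.
by move=> [i _]; case: asboolP => // Bi /= ->.
Qed.

Definition escape s a : set walk :=
  [set X : walk | forall K : R, exists n, K < s * (X n)%:~R - a * n%:R].

Lemma measurable_escape s a : measurable (escape s a).
Proof.
rewrite (_ : escape s a = \bigcap_(K : nat) \bigcup_(n : nat)
    ((fun X : walk => s * (X n)%:~R - a * n%:R) @^-1` `]K%:R, +oo[)).
  apply: bigcapT_measurable => K; apply: bigcupT_measurable => n.
  rewrite -[X in measurable X]setTI; apply: measurable_funB => //.
  by apply: measurable_funM => //; exact: measurable_walk_coord.
apply/seteqP; split => X H.
  by move=> K _; have [n Kn] := H K%:R; exists n => //=; rewrite in_itv/= Kn.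
move=> K; have [n _ /=] := H (Num.truncn K).+1 Logic.I.
rewrite in_itv/= andbT => Kn; exists n; apply: lt_trans Kn.
exact: truncnS_gt.
Qed.

Lemma escape_wcons s a x : wcons x @^-1` escape s a = escape s a.
Proof.
apply/seteqP; split => X H K.
  (* The last summand excludes time 0; [|a|] pays for the shift of time by one. *)
  have [[|n] Kn] := H (`|K| + `|a| + `|s * x%:~R|).
    move: Kn; rewrite /= mulr0 subr0 => Kn; exfalso; move: Kn; apply/negP; rewrite -leNgt.
    by rewrite (le_trans (ler_norm _))// lerDr addr_ge0.
  exists n; move: Kn; rewrite /= -natr1 mulrDr mulr1.
  have := ler_norm K; have := ler_norm (- a); rewrite normrN; have := normr_ge0 (s * x%:~R); lra.
have [n Kn] := H (K + `|a|); exists n.+1; move: Kn; rewrite /= -natr1 mulrDr mulr1.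
have := ler_norm a; lra.
Qed.

Lemma escape_wadd s a z : wadd z @^-1` escape s a = escape s a.
Proof.
apply/seteqP; split => X H K.
  have [n Kn] := H (K + `|s * z%:~R|); exists n; move: Kn; rewrite /= /wadd intrD mulrDr.
  by have := ler_norm (s * z%:~R); lra.
have [n Kn] := H (K + `|s * z%:~R|); exists n; move: Kn; rewrite /= /wadd intrD mulrDr.
by have := ler_norm (- (s * z%:~R)); rewrite normrN; lra.
Qed.

Lemma not_escape s a X : ~ escape s a X ->
  exists K : R, forall n, s * (X n)%:~R <= a * n%:R + K.
Proof.
move=> /existsNP[K /forallNP H]; exists K => n.
by have /negP := H n; rewrite -leNgt; lra.
Qed.

End escape.

(** * The maximal function and its one-step inequality *)

Section maximal_function.
Context {R : realType} (M : nat) (s a : R).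
Implicit Types (X Y : walk) (w : env R) (n : nat).

Definition tail X : walk := fun k => X k.+1.

(* maxfun n X is the maximum over k <= n of s (X_k - X_0) - a k, written as a
   recursion along the shift. *)
Fixpoint maxfun n X : R :=
  if n is n'.+1 then Num.max 0 (s * (X 1%N - X 0%N)%:~R - a + maxfun n' (tail X)) else 0.

Lemma maxfun_ge0 n X : 0 <= maxfun n X.
Proof. by case: n => [|n] //=; rewrite le_max lexx. Qed.

Lemma maxfun_nd n X : maxfun n X <= maxfun n.+1 X.
Proof.
elim: n X => [|n IH] X; first exact: (maxfun_ge0 1).
rewrite /= ge_max le_max lexx/= le_max; apply/orP; right.
by rewrite lerD2l IH.
Qed.

Lemma maxpos_sub n : [set X | 0 < maxfun n X] `<=` [set X | 0 < maxfun n.+1 X].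
Proof. by move=> X /lt_le_trans; apply; exact: maxfun_nd. Qed.

Lemma maxfun_ge n X : s * (X n - X 0%N)%:~R - a * n%:R <= maxfun n X.
Proof.
elim: n X => [|n IH] X; first by rewrite subrr mulr0z !mulr0 subr0.
rewrite [leRHS]/= le_max; apply/orP; right.
have := IH (tail X); rewrite /tail -natr1 !intrB; lra.
Qed.

Lemma maxfun_wadd z n X : maxfun n (wadd z X) = maxfun n X.
Proof.
elim: n X => [//|n IH] X; rewrite /= -[tail (wadd z X)]/(wadd z (tail X)) IH.
by rewrite /wadd opprD addrACA subrr add0r.
Qed.

Lemma measurable_maxfun n : measurable_fun [set: walk] (maxfun n).
Proof.
elim: n => [|n IH] //=; apply: measurable_maxr => //; apply: measurable_funD.
  apply: measurable_funB => //; apply: measurable_funM => //.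
  under eq_fun do rewrite intrB.
  by apply: measurable_funB; exact: measurable_walk_coord.
apply: (measurableT_comp IH); apply: measurable_to_walk => m i.
exact: (measurable_walk_at m.+1 i).
Qed.

Lemma escape_maxfun X : escape s a X -> exists n, 0 < maxfun n X.
Proof.
move=> /(_ (s * (X 0%N)%:~R))[n Kn]; exists n.
by apply: lt_le_trans (maxfun_ge n X); rewrite intrB; lra.
Qed.

(** If the maximum is positive, it equals the first increment plus the maximum of the tail over one
    step less. If it is 0, the bound [c] on the increment suffices. Adding [c] keeps both sides
    nonnegative, and its cost falls only on the event that the maximum is 0. *)
Lemma maxfun_step (c : R) n x Y : `|s * (Y 0%N - x)%:~R - a| <= c ->
  maxfun n.+1 (wcons x Y) + c * (0 < maxfun n.+1 (wcons x Y))%R%:R <=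
  maxfun n.+1 Y + (s * (Y 0%N - x)%:~R - a + c).
Proof.
rewrite ler_norml => /andP[dc1 dc2].
rewrite [X in X + _ * (0 < X)%R%:R]/= -[tail (wcons x Y)]/(Y).
have := maxfun_nd n Y; have := maxfun_ge0 n.+1 Y.
set d := s * _ - a in dc1 dc2 *; set g := maxfun n.+1 Y; set g' := maxfun n Y => g0 gg.
have [h|h] := leP (d + g') 0.
  by rewrite ltxx mulr0; lra.
by rewrite h mulr1; lra.
Qed.

(** With the crude [fdrift_bd M] in place of [M], one constant bounds both a single increment and
    the mean increment [s * fdrift M w x - a]. *)
Definition step_bd : R := `|s| * fdrift_bd M + `|a|.

Lemma step_bd_ge0 : 0 <= step_bd.
Proof. by rewrite addr_ge0// mulr_ge0// ler0n. Qed.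

Lemma step_bdP x (k : 'I_(M.*2.+1)) : `|s * (nb M x k - x)%:~R - a| <= step_bd.
Proof.
rewrite (le_trans (ler_normB _ _))// lerD2r normrM ler_wpM2l//.
rewrite -intr_norm /fdrift_bd -[(_ * _)%N%:R]/((_ * _)%N%:Z%:~R) ler_int.
have := nb_dist x k; have : (M <= M.*2.+1 * M)%N by rewrite leq_pmull.
by clear; lia.
Qed.

Lemma ae_quenched_start w x : \forall X \ae quenched w x, X 0%N = x.
Proof.
apply: (ae_prob1 (measurable_walk_at 0 x)).
have := quenched_markov w x 0 (fun=> x); rewrite big_ord0 eqxx mulr1 => <-.
congr (quenched _ _ _); apply/seteqP; split => X /=; last exact.
by move=> Xx k; rewrite leqn0 => /eqP ->.
Qed.

Definition maxmean n w x : \bar R := (\int[quenched w x]_X (maxfun n X)%:E)%E.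

Lemma maxmean_ge0 n w x : (0 <= maxmean n w x)%E.
Proof. by apply: integral_ge0 => X _; rewrite lee_fin maxfun_ge0. Qed.

Let mmax n : measurable_fun [set: walk] (EFin \o maxfun n).
Proof. by apply/measurable_EFinP; exact: measurable_maxfun. Qed.

Lemma measurable_maxmean n x : measurable_fun [set: env R] (fun w => maxmean n w x).
Proof.
apply: (@measurable_fun_integral_kernel _ _ _ _ _ (fun w => quenched w x)) => //.
- by move=> U mU; exact: measurable_quenched.
- by move=> X; rewrite lee_fin maxfun_ge0.
- exact: mmax.
Qed.

Lemma maxmean_shift n w z : maxmean n (env_shift z w) 0 = maxmean n w z.
Proof.
rewrite /maxmean; transitivity (\int[distribution (quenched (env_shift z w) 0) (wadd z)]_X
    (maxfun n X)%:E)%E.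
  rewrite ge0_integral_pushforward//; last 2 first.
  - exact: mmax.
  - by move=> X _; rewrite lee_fin maxfun_ge0.
  by apply: eq_integral => X _ /=; rewrite maxfun_wadd.
apply: eq_measure_integral => A mA _; apply/esym.
by have := quenched_shift w z 0 mA; rewrite addr0.
Qed.

Lemma maxmean_le n w x : ranged M w -> (maxmean n w x <= (n%:R * step_bd)%:E)%E.
Proof.
move=> wM; elim: n x => [|n IH] x.
  by rewrite /maxmean/= integral0_eq// mul0r.
rewrite /maxmean (integral_quenched_step _ wM); last 2 first.
- exact: mmax.
- by move=> X; rewrite lee_fin maxfun_ge0.
apply: (@le_trans _ _ (\sum_(k < M.*2.+1) (w x (nb M x k) * (n.+1%:R * step_bd))%:E)%E).
  apply: lee_sum => k _; rewrite EFinM lee_wpmul2l ?lee_fin ?env_ge0//.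
  apply: (@le_trans _ _ (\int[quenched w (nb M x k)]_X (step_bd%:E + (maxfun n X)%:E))%E).
    apply: ae_ge0_le_integral => //.
    - by move=> X _; rewrite lee_fin maxfun_ge0.
    - exact: (measurableT_comp (mmax n.+1) (measurable_wcons x)).
    - by move=> X _; rewrite -EFinD lee_fin addr_ge0 ?maxfun_ge0 ?step_bd_ge0.
    - by apply: emeasurable_funD => //; exact: mmax.
    - have := ae_quenched_start w (nb M x k).
      apply: (@filterS _ _ (ae_filter_ringOfSetsType (quenched w (nb M x k)))) => X X0 _.
      rewrite -EFinD lee_fin /= -[tail (wcons x X)]/(X) ge_max; apply/andP; split.
        by rewrite addr_ge0 ?maxfun_ge0 ?step_bd_ge0.
      by rewrite lerD2r (le_trans (ler_norm _))// X0 step_bdP.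
  rewrite ge0_integralD//; last 3 first.
  - by move=> X _; rewrite lee_fin step_bd_ge0.
  - by move=> X _; rewrite lee_fin maxfun_ge0.
  - exact: mmax.
  rewrite integral_cst// [X in (_ * X + _)%E]probability_setT mule1.
  have -> : ((n.+1%:R * step_bd)%:E = step_bd%:E + (n%:R * step_bd)%:E)%E.
    by rewrite -EFinD -natr1 mulrDl mul1r addrC.
  by apply: leeD2l; exact: IH.
rewrite sumEFin -mulr_suml env_sum_nb// mul1r//.
Qed.

Definition maxpos n w : \bar R := quenched w 0 [set X | 0 < maxfun n X].

Lemma measurable_maxpos_set n : measurable [set X : walk | 0 < maxfun n X].
Proof.
rewrite (_ : [set X | _] = maxfun n @^-1` `]0, +oo[); last first.
  by apply/seteqP; split => X /=; rewrite in_itv/= andbT.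
by rewrite -[X in measurable X]setTI; exact: measurable_maxfun.
Qed.

Lemma measurable_maxpos n : measurable_fun [set: env R] (maxpos n).
Proof. by apply: measurable_quenched; exact: measurable_maxpos_set. Qed.

(* The pointwise inequality of Garsia's proof of the maximal ergodic lemma. *)
Lemma maximal_ineq n w : ranged M w ->
  (maxmean n.+1 w 0 + step_bd%:E * maxpos n.+1 w <=
   \sum_(k < M.*2.+1) (w 0 (nb M 0 k))%:E * maxmean n.+1 (env_shift (nb M 0 k) w) 0 +
   (s * fdrift M w 0 - a + step_bd)%:E)%E.
Proof.
move=> wM; set c := step_bd.
have c0 : 0 <= c by exact: step_bd_ge0.
pose A := [set X : walk | 0 < maxfun n.+1 X].
have mA : measurable A by exact: measurable_maxpos_set.
pose psi X : \bar R := (maxfun n.+1 X + c * \1_A X)%:E.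
have mpsi : measurable_fun [set: walk] psi.
  apply/measurable_EFinP; apply: measurable_funD; first exact: measurable_maxfun.
  by apply: measurable_funM => //; exact: measurable_indic.
have psi0 X : (0 <= psi X)%E by rewrite lee_fin addr_ge0 ?maxfun_ge0// mulr_ge0.
have -> : (maxmean n.+1 w 0 + c%:E * maxpos n.+1 w = \int[quenched w 0]_X psi X)%E.
  rewrite /psi; under [RHS]eq_integral do rewrite EFinD EFinM.
  rewrite ge0_integralD//; last 4 first.
  - by move=> X _; rewrite lee_fin maxfun_ge0.
  - exact: mmax.
  - by move=> X _; rewrite -EFinM lee_fin mulr_ge0.
  - by apply: emeasurable_funM => //; apply/measurable_EFinP; exact: measurable_indic.
  rewrite ge0_integralZl_EFin//; last first.
    by apply/measurable_EFinP; exact: measurable_indic.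
  by rewrite integral_indic// setIT.
rewrite (integral_quenched_step _ wM)//.
have -> : (s * fdrift M w 0 - a + c)%:E = (\sum_(k < M.*2.+1)
    (w 0 (nb M 0 k))%:E * (s * (nb M 0 k - 0)%:~R - a + c)%:E)%E.
  under eq_bigr do rewrite -EFinM.
  rewrite sumEFin; congr EFin.
  under eq_bigr do rewrite -addrA mulrDr.
  rewrite big_split/= -mulr_suml env_sum_nb// mul1r -[LHS]addrA; congr (_ + _).
  rewrite mulr_sumr; apply: eq_bigr => k _.
  rewrite subr0 (_ : nb M 0 k = k%:Z - M%:Z); last by rewrite /nb add0r.
  by move: ((k%:Z - M%:Z)%:~R : R) (w 0 _) => u v; ring.
rewrite -big_split/=; apply: lee_sum => k _.
have d0 : 0 <= s * (nb M 0 k - 0)%:~R - a + c.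
  by have := step_bdP 0 k; rewrite ler_norml -/c => /andP[]; lra.
rewrite -ge0_muleDr ?maxmean_ge0 ?lee_fin//.
rewrite lee_wpmul2l ?lee_fin ?env_ge0// maxmean_shift /maxmean.
rewrite -[X in (_ + X)%E](_ : \int[quenched w (nb M 0 k)]_X
    (cst (s * (nb M 0 k - 0)%:~R - a + c)%:E) X = _)%E; last first.
  by rewrite integral_cst// [X in (_ * X)%E]probability_setT mule1.
rewrite -ge0_integralD//; last 2 first.
- by move=> X _; rewrite lee_fin maxfun_ge0.
- exact: mmax.
apply: ae_ge0_le_integral => //.
- exact: (measurableT_comp mpsi (measurable_wcons 0)).
- by move=> X _; rewrite adde_ge0 ?lee_fin ?maxfun_ge0.
- by apply: emeasurable_funD => //; exact: mmax.
have := ae_quenched_start w (nb M 0 k).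
apply: (@filterS _ _ (ae_filter_ringOfSetsType (quenched w (nb M 0 k)))) => X X0 _.
rewrite /psi -EFinD lee_fin indicE.
have := @maxfun_step c n 0 X; rewrite X0 => /(_ (step_bdP 0 k)).
suff -> : (wcons 0 X \in A) = (0 < maxfun n.+1 (wcons 0 X)) by [].
by apply/idP/idP; rewrite inE.
Qed.

End maximal_function.

(** * Maximal ergodic inequality under the invariant measure *)

Section ergodic_bound.
Context {R : realType} (M : nat) (P : probability (env R) R)
  (Pinv : shift_invariant P) (PM : finite_range P M) (f : env R -> R).
Hypotheses (mf : measurable_fun setT f) (f0 : forall w, 0 <= f w)
  (f1 : (\int[P]_w (f w)%:E = 1)%E)
  (finv : \forall w \ae P, f w =
    \sum_(k < M.*2.+1) f (env_shift (nb M 0 k) w) * (w : env R) (nb M 0 k) 0).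
Implicit Types (w : env R).

Let fE0 w : (0 <= (f w)%:E)%E. Proof. by rewrite lee_fin. Qed.

Let mfE : measurable_fun setT (fun w => (f w)%:E). Proof. exact/measurable_EFinP. Qed.

Let integrable_f : P.-integrable setT (fun w => (f w)%:E).
Proof.
apply/integrableP; split => //.
by under eq_integral do rewrite gee0_abs//; rewrite f1 ltry.
Qed.

Let integrable_Df : P.-integrable setT (fun w => (fdrift M w 0 * f w)%:E).
Proof.
have : P.-integrable setT (fun w => (fdrift_bd M)%:E * (f w)%:E)%E by exact: integrableZl.
apply: le_integrable => //.
  by apply/measurable_EFinP; apply: measurable_funM => //; exact: measurable_fdrift.
move=> w _; rewrite -EFinM !abse_EFin lee_fin !normrM ler_wpM2r//.
by rewrite (le_trans (fdrift_le _ _ _))// ler_norm.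
Qed.

Definition speed : R := fine (\int[P]_w (fdrift M w 0 * f w)%:E)%E.

Lemma integral_affine_drift (s b : R) :
  (\int[P]_w ((s * fdrift M w 0 + b) * f w)%:E = (s * speed + b)%:E)%E.
Proof.
under eq_integral do rewrite mulrDl -mulrA EFinD EFinM [(b * _)%:E]EFinM.
rewrite integralD//; [|exact: integrableZl..].
rewrite !integralZl// f1 mule1 EFinD EFinM /speed fineK//.
exact: integrable_fin_num.
Qed.

Lemma expectation_drift : ('E_(Pinf P mf f0)[@drift R] = speed%:E)%E.
Proof.
set Q := Pinf P mf f0; rewrite unlock.
have mD : measurable_fun setT (fun w => fdrift M w 0) by exact: measurable_fdrift.
(* [integral_Pinf] concerns nonnegative functions, so the drift is shifted by its bound, which is
   subtracted at the end. *)
pose b : R := fdrift_bd M.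
have Db w : 0 <= fdrift M w 0 + b.
  by have := fdrift_le M w 0; rewrite ler_norml /b => /andP[]; lra.
have H : (\int[Q]_w (fdrift M w 0 + b)%:E = speed%:E + b%:E)%E.
  rewrite integral_Pinf//; last first.
    by apply/measurable_EFinP; exact: measurable_funD.
  under eq_integral do rewrite -EFinM -[fdrift M _ 0]mul1r.
  by rewrite integral_affine_drift mul1r.
have iD : Q.-integrable setT (fun w => (fdrift M w 0)%:E).
  apply: (@le_integrable _ _ _ _ _ measurableT _ (EFin \o cst b)).
  - exact/measurable_EFinP.
  - move=> w _; rewrite !abse_EFin lee_fin (le_trans (fdrift_le _ _ _))//.
    by rewrite ler_norm.
  - exact: finite_measure_integrable_cst.
have H2 : (\int[Q]_w (fdrift M w 0 + b)%:E = \int[Q]_w (fdrift M w 0)%:E + b%:E)%E.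
  under eq_integral do rewrite EFinD.
  rewrite integralD//; last exact: finite_measure_integrable_cst.
  by rewrite integral_cst// [X in (_ * X)%E]probability_setT mule1.
transitivity (\int[Q]_w (fdrift M w 0)%:E)%E.
  apply: ae_eq_integral => //.
  - by apply/measurable_EFinP; exact: measurable_drift.
  - exact/measurable_EFinP.
  have [N [mN PN NP]] := ae_ranged PM.
  have /null_content_dominatesP dQ := Pinf_dominates mf f0 f1.
  exists N; split => //; first exact: dQ.
  move=> w /= nw; apply: NP => /= wM; apply: nw => _.
  by rewrite -(drift_shiftE 0 wM) env_shift_0.
move: H; rewrite H2 -(fineK (integrable_fin_num measurableT iD)) -!EFinD.
by move=> -[] /addIr ->.
Qed.

(** Integrating [maximal_ineq] against [f], stationarity cancels the two mean maxima, which are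
    finite. What remains bounds [c] times the probability of a positive maximum by
    [s * speed + c - a]. Escape makes this probability tend to 1, and [c] drops out. *)
Lemma speed_ge (s a : R) :
  (\forall w \ae P, quenched w 0 (escape s a) = 1%E) -> a <= s * speed.
Proof.
move=> aeB; set c := step_bd M s a.
have c0 : 0 <= c by exact: step_bd_ge0.
have mm n : measurable_fun setT (fun w => maxmean s a n w 0) by exact: measurable_maxmean.
have mp n : measurable_fun setT (maxpos s a n : env R -> \bar R) by exact: measurable_maxpos.
have mm0 n w : (0 <= maxmean s a n w 0)%E by exact: maxmean_ge0.
have mp0 n w : (0 <= maxpos s a n w)%E by exact: measure_ge0.
have d0 w : 0 <= s * fdrift M w 0 - a + c.
  have := ler_norm (- (s * fdrift M w 0)); rewrite normrN normrM => H1.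
  have H2 := ler_wpM2l (normr_ge0 s) (fdrift_le M w 0).
  have H3 := ler_norm a.
  by rewrite /c /step_bd; lra.
have mmf n : measurable_fun setT (fun w => maxmean s a n w 0 * (f w)%:E)%E.
  exact: emeasurable_funM.
have mpf n : measurable_fun setT (fun w => maxpos s a n w * (f w)%:E)%E.
  exact: emeasurable_funM.
have Ifin n : (\int[P]_w (maxmean s a n w 0 * (f w)%:E) \is a fin_num)%E.
  rewrite ge0_fin_numE ?integral_ge0//; last by move=> w _; rewrite mule_ge0.
  apply: (@le_lt_trans _ _ (\int[P]_w ((n%:R * c)%:E * (f w)%:E))%E).
    apply: ae_ge0_le_integral => //.
    - by move=> w _; rewrite mule_ge0.
    - by move=> w _; rewrite mule_ge0// lee_fin mulr_ge0.
    - exact: emeasurable_funM.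
    - have := ae_ranged PM; apply: filterS => w wM _.
      by rewrite lee_wpmul2r// maxmean_le.
  rewrite ge0_integralZl_EFin//; last by rewrite mulr_ge0.
  by rewrite f1 mule1 ltry.
have key n : (c%:E * \int[P]_w (maxpos s a n.+1 w * (f w)%:E) <= (s * speed + (c - a))%:E)%E.
  pose g w := maxmean s a n.+1 w 0.
  have H : (\int[P]_w ((g w + c%:E * maxpos s a n.+1 w) * (f w)%:E) <=
      \int[P]_w ((\sum_(k < M.*2.+1) (w 0 (nb M 0 k))%:E * g (env_shift (nb M 0 k) w) +
         (s * fdrift M w 0 - a + c)%:E) * (f w)%:E))%E.
    apply: ae_ge0_le_integral => //.
    - by move=> w _; rewrite mule_ge0// adde_ge0// ?mm0// mule_ge0.
    - apply: emeasurable_funM => //; apply: emeasurable_funD => //; first exact: mm.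
      exact: emeasurable_funM.
    - move=> w _; rewrite mule_ge0// adde_ge0 ?lee_fin ?d0//.
      by apply: sume_ge0 => k _; rewrite mule_ge0 ?lee_fin ?env_ge0// mm0.
    - apply: emeasurable_funM => //; apply: emeasurable_funD.
        apply: emeasurable_sum => k; apply: emeasurable_funM.
          by apply/measurable_EFinP; exact: measurable_env_at.
        exact: (measurableT_comp (mm n.+1) (@measurable_env_shift R _)).
      apply/measurable_EFinP; apply: measurable_funD => //; apply: measurable_funB => //.
      by apply: measurable_funM => //; exact: measurable_fdrift.
    - have := ae_ranged PM; apply: filterS => w wM _.
      by rewrite lee_wpmul2r//; exact: maximal_ineq.
  move: H.
  under eq_integral => w _ do rewrite ge0_muleDl ?mm0 ?mule_ge0// -muleA.
  rewrite ge0_integralD//; last 4 first.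
  - by move=> w _; rewrite mule_ge0//; exact: mm0.
  - exact: mmf.
  - by move=> w _; rewrite !mule_ge0.
  - by apply: emeasurable_funM => //; exact: mpf.
  rewrite ge0_integralZl_EFin//; last by move=> w _; rewrite mule_ge0.
  have S0 w : (0 <= \sum_(k < M.*2.+1) (w 0 (nb M 0 k))%:E * g (env_shift (nb M 0 k) w))%E.
    by apply: sume_ge0 => k _; rewrite mule_ge0 ?lee_fin ?env_ge0// mm0.
  under [leRHS]eq_integral => w _ do
    rewrite ge0_muleDl ?S0 ?lee_fin ?d0// -EFinM -addrA [(- a + c)%R]addrC.
  rewrite [leRHS]ge0_integralD//; last 4 first.
  - by move=> w _; rewrite mule_ge0.
  - apply: emeasurable_funM => //; apply: emeasurable_sum => k; apply: emeasurable_funM.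
      by apply/measurable_EFinP; exact: measurable_env_at.
    exact: (measurableT_comp (mm n.+1) (@measurable_env_shift R _)).
  - by move=> w _; rewrite lee_fin mulr_ge0//; have := d0 w; lra.
  - apply/measurable_EFinP; apply: measurable_funM => //; apply: measurable_funD => //.
    by apply: measurable_funM => //; exact: measurable_fdrift.
  rewrite (stationary Pinv mf f0 finv (mm n.+1) (mm0 n.+1)) integral_affine_drift.
  by rewrite leeD2lE //; exact: Ifin.
(* No division by [c] is possible when it is 0, but then [d0] says that [s * fdrift M w 0 - a] is
   itself nonnegative. *)
have [c_le0|c_gt0] := leP c 0.
  have ce : c = 0 by apply/eqP; rewrite eq_le c_le0.
  have : (0 <= \int[P]_w ((s * fdrift M w 0 + (c - a)) * f w)%:E)%E.
    by apply: integral_ge0 => w _; rewrite lee_fin mulr_ge0//; have := d0 w; lra.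
  by rewrite integral_affine_drift lee_fin ce; lra.
pose L w := quenched w 0 (\bigcup_n [set X | 0 < maxfun s a n.+1 X]).
have mA n : measurable [set X : walk | 0 < maxfun s a n X] by exact: measurable_maxpos_set.
have mU : measurable (\bigcup_n [set X : walk | 0 < maxfun s a n.+1 X]).
  exact: bigcupT_measurable.
have mL : measurable_fun setT L by exact: measurable_quenched.
have nd : nondecreasing_seq (fun n => [set X : walk | 0 < maxfun s a n.+1 X]).
  by apply/nondecreasing_seqP => n; apply/subsetPset => X; exact: maxpos_sub.
have cvgL w : (maxpos s a n.+1 w * (f w)%:E)%E @[n --> \oo] --> (L w * (f w)%:E)%E.
  apply: cvgeZr => //; exact: nondecreasing_cvg_mu.
have intL : (\int[P]_w (L w * (f w)%:E) =
    limn (fun n => \int[P]_w (maxpos s a n.+1 w * (f w)%:E)))%E.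
  rewrite -monotone_convergence//.
  - by apply: eq_integral => w _; apply/esym/cvg_lim => //; exact: cvgL.
  - by move=> n w _; rewrite mule_ge0.
  - move=> w _ m n mn; rewrite lee_wpmul2r//.
    by apply: le_measure; rewrite ?inE//; apply/subsetPset; exact: nd.
have L1 : (1 <= \int[P]_w (L w * (f w)%:E))%E.
  rewrite -f1; apply: ae_ge0_le_integral => //.
  - by move=> w _; rewrite mule_ge0// measure_ge0.
  - exact: emeasurable_funM.
  move: aeB; apply: filterS => w Bw _.
  rewrite -[leLHS]mul1e lee_wpmul2r// -Bw le_measure ?inE//.
    exact: measurable_escape.
  move=> X /escape_maxfun[n Xn]; exists n => //.
  exact: maxpos_sub Xn.
have L2 : (\int[P]_w (L w * (f w)%:E) <= (c^-1 * (s * speed + (c - a)))%:E)%E.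
  rewrite intL; apply: lime_le.
    apply: ereal_nondecreasing_is_cvgn => m n mn; apply: ge0_le_integral => //.
    - by move=> w _; rewrite mule_ge0.
    - by move=> w _; rewrite lee_wpmul2r//; apply: le_measure; rewrite ?inE//;
        apply/subsetPset; exact: nd.
  by apply: nearW => n; rewrite EFinM muleC lee_pdivlMr// muleC.
have := le_trans L1 L2; rewrite lee_fin mulrC ler_pdivlMr// mul1r; lra.
Qed.

End ergodic_bound.

(** * The law of large numbers *)

Section law_of_large_numbers.
Context {R : realType} (M : nat) (M1 : (1 <= M)%N) (P : probability (env R) R)
  (Pinv : shift_invariant P) (Perg : shift_ergodic P) (PM : finite_range P M)
  (PK : kalikow P M) (f : env R -> R).
Hypotheses (mf : measurable_fun setT f) (f0 : forall w, 0 <= f w)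
  (f1 : (\int[P]_w (f w)%:E = 1)%E)
  (finv : \forall w \ae P, f w =
    \sum_(k < M.*2.+1) f (env_shift (nb M 0 k) w) * (w : env R) (nb M 0 k) 0).
Implicit Types (w : env R) (s a : R).

(* The quenched probability of escape is shift invariant and 0 or 1 on the good
   environments; ergodicity then makes it constant. *)
Lemma escape_null s a : s * speed M P f < a ->
  \forall w \ae P, quenched w 0 (escape s a) = 0%E.
Proof.
move=> sa; have [kappa k0 [N [mN PN NP]]] := ae_good M1 Pinv PM PK.
(* [shift_ergodic] is about strictly invariant measurable sets: keeping the environments all of
   whose shifts avoid [N] yields one of full measure. *)
pose G := [set w | forall z : int, (~` N) (env_shift z w)].
have Gg w : G w -> good M kappa w.
  move=> /(_ 0); rewrite env_shift_0 => nN; apply: contrapT => ng.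
  exact/nN/NP.
have mG : measurable G.
  apply: measurable_forall_int => z.
  rewrite -[X in measurable X]setTI; apply: measurable_env_shift => //.
  exact: measurableC.
have aeG : \forall w \ae P, G w.
  apply: ae_forall_int => z; apply: (@ae_shift R P Pinv z (fun w => (~` N) w)).
  by exists N; split => // w /=; rewrite notK.
have Gshift k : env_shift k @^-1` G = G.
  apply/seteqP; split => w /= H z.
    by have := H (z - k); rewrite env_shiftD addrC subrK.
  by rewrite env_shiftD; exact: H.
have mB := @measurable_escape R s a.
have const w z : G w -> quenched (env_shift z w) 0 (escape s a) = quenched w 0 (escape s a).
  move=> /Gg gw; have := quenched_shift w z 0 mB; rewrite escape_wadd => <-.
  exact: (quenched_invariant_const M1 k0 gw mB (escape_wcons s a)).
pose A := G `&` [set w | quenched w 0 (escape s a) = 1%E].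
have mA : measurable A.
  apply: measurableI => //.
  rewrite (_ : [set w | _] = (fun w => quenched w 0 (escape s a)) @^-1` [set 1%E]) //.
  by rewrite -[X in measurable X]setTI; apply: measurable_quenched.
have Ashift k : env_shift k @^-1` A = A.
  rewrite /A preimage_setI Gshift; apply/seteqP; split => w /= [Gw Hw]; split => //.
    by rewrite -(const w k).
  by rewrite const.
have [PA|PA] := Perg mA Ashift.
  have aeA : \forall w \ae P, (~` A) w by exists A; split => // w /=; rewrite notK.
  apply: filterS2 aeG aeA => w Gw nA.
  have [//|H] := quenched_zero_one M1 k0 (Gg _ Gw) mB (escape_wcons s a) 0.
  by case: nA.
have aeA := ae_prob1 mA PA.
have : a <= s * speed M P f.
  by apply: (speed_ge Pinv PM mf f0 f1 finv); apply: filterS aeA => w [].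
by rewrite leNgt sa.
Qed.

Definition lln_event (v : R) : set walk :=
  [set X : walk | ((X n)%:~R / n%:R : R) @[n --> \oo] --> v].

Lemma measurable_lln_event v : measurable (lln_event v).
Proof.
have mc n : measurable_fun [set: walk] (fun X : walk => (X n)%:~R / n%:R : R).
  by apply: measurable_funM => //; exact: measurable_walk_coord.
rewrite (_ : lln_event v = \bigcap_(k : nat) \bigcup_(N : nat) \bigcap_(n : nat)
   (if (N <= n)%N then (fun X : walk => `|v - (X n)%:~R / n%:R|) @^-1` `]-oo, k.+1%:R^-1] else setT)).
  apply: bigcapT_measurable => k; apply: bigcupT_measurable => N.
  apply: bigcapT_measurable => n; case: ifP => // _.
  rewrite -[X in measurable X]setTI.
  have : measurable_fun [set: walk] (fun X : walk => `|v - (X n)%:~R / n%:R|).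
    by apply: measurableT_comp => //; exact: measurable_funB.
  by apply.
apply/seteqP; split => X H.
  move=> k _; have k0 : 0 < k.+1%:R^-1 :> R by rewrite invr_gt0.
  move/cvgrPdist_le : H => /(_ _ k0)[N _ HN]; exists N => // n _.
  by case: ifP => // Nn; rewrite /= in_itv/=; exact: HN.
apply/cvgrPdist_le => e e0.
have [N _ HN] := H (Num.truncn e^-1) Logic.I.
exists N => // n /= Nn; have := HN n Logic.I; rewrite Nn /= in_itv/= => /le_trans; apply.
by rewrite invf_ple ?posrE// ltW// truncnS_gt.
Qed.

(** The levels [v + 1/(k+1)] for [s = 1] and [- v + 1/(k+1)] for [s = -1] exceed [s * v], so escape
    is null at each of these countably many levels. Off them, [X n] stays within [n / (k+1)] of
    [v * n] up to a constant that depends on the path. *)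
Lemma lln_quenched : \forall w \ae P, quenched w 0 (lln_event (speed M P f)) = 1%E.
Proof.
set v := speed M P f.
have H1 : \forall w \ae P, forall k : nat,
    quenched w 0 (escape 1 (v + k.+1%:R^-1)) = 0%E.
  apply: ae_foralln => k; apply: escape_null.
  by rewrite mul1r ltrDl invr_gt0.
have H2 : \forall w \ae P, forall k : nat,
    quenched w 0 (escape (-1) (- v + k.+1%:R^-1)) = 0%E.
  apply: ae_foralln => k; apply: escape_null.
  by rewrite mulN1r ltrDl invr_gt0.
apply: filterS2 H1 H2 => w h1 h2.
pose E k := escape 1 (v + k.+1%:R^-1) `|` escape (-1) (- v + k.+1%:R^-1).
have mE k : measurable (E k) by apply: measurableU; exact: measurable_escape.
have mL := measurable_lln_event v.
have E0 : quenched w 0 (\bigcup_k E k) = 0%E.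
  apply/negligibleP; first exact: bigcupT_measurable.
  apply: negligible_bigcup => k; apply: negligibleU; apply/negligibleP;
    by [exact: measurable_escape|exact: h1|exact: h2].
have sub : ~` lln_event v `<=` \bigcup_k E k.
  move=> X nX; apply: contrapT => nE; apply: nX.
  apply/cvgrPdist_le => e e0.
  (* Half of [e] is spent on the slope [1/(k+1)], the other half on the constants, which is possible
     from time [2 * K / e] on. *)
  pose k := Num.truncn (2 / e).
  have ke : k.+1%:R^-1 <= e / 2.
    by rewrite -[e / 2]invrK lef_pV2 ?posrE ?invr_gt0 ?divr_gt0// invf_div ltW// truncnS_gt.
  have [K1 HK1] : exists K1 : R, forall n, 1 * (X n)%:~R <= (v + k.+1%:R^-1) * n%:R + K1.
    by apply: not_escape => H; apply: nE; exists k => //; left.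
  have [K2 HK2] : exists K2 : R, forall n, -1 * (X n)%:~R <= (- v + k.+1%:R^-1) * n%:R + K2.
    by apply: not_escape => H; apply: nE; exists k => //; right.
  pose K := `|K1| + `|K2|.
  exists (Num.truncn (2 * K / e)).+1 => // n /= Kn.
  have n0 : 0 < n%:R :> R by rewrite ltr0n (leq_trans _ Kn).
  have Kn' : K <= e / 2 * n%:R.
    have : 2 * K / e <= n%:R.
      by rewrite (le_trans (ltW (truncnS_gt _)))// ler_nat.
    by rewrite ler_pdivrMr//; lra.
  have squeeze (x y d c k1 k2 : R) : x <= y + d + k1 -> - x <= - y + d + k2 ->
      d <= c -> `|k1| + `|k2| <= c -> `|y - x| <= c + c.
    move=> h1' h2' dc kc; have := ler_norm k1; have := ler_norm k2.
    have := normr_ge0 k1; have := normr_ge0 k2.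
    by rewrite ler_norml => *; apply/andP; split; lra.
  have -> : v - (X n)%:~R / n%:R = (v * n%:R - (X n)%:~R) / n%:R.
    by rewrite mulrBl mulfK// gt_eqF.
  rewrite normrM normfV (gtr0_norm n0) ler_pdivrMr//.
  have -> : e * n%:R = e / 2 * n%:R + e / 2 * n%:R by rewrite -mulrDl -splitr.
  apply: (squeeze _ _ (k.+1%:R^-1 * n%:R) _ _ _ _ _ _ Kn').
  - by have := HK1 n; rewrite mul1r mulrDl; exact.
  - by have := HK2 n; rewrite mulN1r mulrDl mulNr; exact.
  - by rewrite ler_wpM2r // ltW.
have : quenched w 0 (~` lln_event v) = 0%E.
  apply/eqP; rewrite eq_le measure_ge0 andbT -E0 le_measure ?inE//.
    exact: measurableC.
  exact: bigcupT_measurable.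
rewrite probability_setC// => /eqP; rewrite sube_eq ?fin_num_adde_defr ?fin_num_measure//.
by rewrite add0e => /eqP.
Qed.

End law_of_large_numbers.

Theorem theorem1 (R : realType) (M : nat) (hM : (1 <= M)%N)
    (P : probability (env R) R)
    (Pinv : shift_invariant P) (Perg : shift_ergodic P)
    (PM : finite_range P M) (PK : kalikow P M) :
  exists Pinf : probability (env R) R,
    [/\ env_process_invariant Pinf,
        Pinf `<< P &
        annealed P 0 [set wX : env R * walk |
          (((wX.2 n)%:~R / n%:R : R)%:E @[n --> \oo] -->
             'E_Pinf[@drift R])%E] = 1%E].
Proof.
have [f [mf f0 f1 _ finv]] := invariant_density hM Pinv PM PK.
exists (Pinf P mf f0); split.
- by apply: (Pinf_invariant Pinv PM mf f0 f1); exact: finv.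
- exact: Pinf_dominates.
rewrite (expectation_drift PM) // /annealed.
(* Convergence in the extended reals to a finite limit is convergence of the real quotients. *)
have -> : (fun w => quenched w 0 [set X | [set wX : env R * walk |
    (((wX.2 n)%:~R / n%:R : R)%:E @[n --> \oo] --> (speed M P f)%:E)%E] (w, X)]) =
    (fun w => quenched w 0 (lln_event (speed M P f))).
  apply/funext => w; congr (quenched _ _ _); apply/seteqP; split => X /= H.
    exact: fine_cvg H.
  by apply: cvg_EFin => //; exact: nearW.
rewrite (ae_eq_integral (cst 1%E))//.
- by rewrite integral_cst// [X in (_ * X)%E]probability_setT mule1.
- by apply: measurable_quenched; exact: measurable_lln_event.
have := lln_quenched hM Pinv Perg PM PK mf f0 f1 finv.
by apply: filterS => w Hw _.
Qed.
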